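(* Let $q=2^e$ with $e\ge1$, let $v\ge1$, and let $m=2^vn$ with $n=p_1^{e_1}\cdots p_s^{e_s}$, where $p_1,\dots,p_s$ are distinct odd primes and $e_1,\dots,e_s$ are positive integers, the primes being ordered so that $v_2(\mathrm{ord}_{p_1}(q))\le\cdots\le v_2(\mathrm{ord}_{p_s}(q))$. Then: (1) $|\Sigma(n;q)|=\sum_{0\le y_1\le e_1}\cdots\sum_{0\le y_s\le e_s}\dfrac{\phi(p_1^{e_1-y_1})\cdots\phi(p_s^{e_s-y_s})}{\mathrm{lcm}(f_{1,y_1},\dots,f_{s,y_s})}$. (2) For any $1\le k\le t$, $$|\Sigma_k|=\sum_{0\le y_{s_{k-1}+1}\le e_{s_{k-1}+1}}\cdots\sum_{0\le y_{s_k}\le e_{s_k}}\frac{\phi(p_{s_{k-1}+1}^{e_{s_{k-1}+1}-y_{s_{k-1}+1}})\cdots\phi(p_{s_k}^{e_{s_k}-y_{s_k}})}{\mathrm{lcm}(f_{s_{k-1}+1,y_{s_{k-1}+1}},\dots,f_{s_k,y_{s_k}})}.$$ (3) $|\Sigma'(n;q)|=\sum_{k=1}^t|\Sigma_k|$, and $|\Sigma''(n;q)|=|\Sigma(n;q)|-|\Sigma'(n;q)|$. (4) There are in total $(2^v+1)^{\frac{|\Sigma''(n;q)|}{2}}$ self-dual cyclic codes of length $m$ over the finite field $\mathbb{F}_q$.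
   Context: A cyclic code of length $m$ over $\mathbb{F}_q$ is an $\mathbb{F}_q$-subspace of $\mathbb{F}_q^m$ stable under the cyclic shift; a code $\mathcal{C}$ is self-dual if $\mathcal{C}=\mathcal{C}^{\perp}$ for the Euclidean product $\langle x,y\rangle=\sum x_iy_i$. $v_2$ is the $2$-adic valuation; $\mathrm{ord}_N(q)$ is the multiplicative order of $q$ modulo $N$, with $\mathrm{ord}_1(q)=1$; $\phi$ is Euler's function. For $0\le y_i\le e_i$ put $f_{i,y_i}=\mathrm{ord}_{p_i^{e_i-y_i}}(q)$, $g_{i,y_i}=\phi(p_i^{e_i-y_i})/f_{i,y_i}$. $\Sigma(n;q)$ is the set of $2s$-tuples of integers $(y,x)=(y_1,\dots,y_s,x_1,\dots,x_s)$ with $0\le y_i\le e_i$ and $0\le x_i\le g_{i,y_i}\gcd(\mathrm{lcm}(f_{1,y_1},\dots,f_{i-1,y_{i-1}}),f_{i,y_i})-1$ for all $i$ (for $i=1$ the gcd is understood to be $1$). The primes are grouped by indices $0\le s_1<\cdots<s_t=s$ (with $s_0=0$) such that $$0=v_2(\mathrm{ord}_{p_1}(q))=\cdots=v_2(\mathrm{ord}_{p_{s_1}}(q))<v_2(\mathrm{ord}_{p_{s_1+1}}(q))=\cdots=v_2(\mathrm{ord}_{p_{s_2}}(q))<\cdots<v_2(\mathrm{ord}_{p_{s_{t-1}+1}}(q))=\cdots=v_2(\mathrm{ord}_{p_{s_t}}(q)).$$ For $1\le k\le t$, $\Sigma_k=\{(y,x)\in\Sigma(n;q):y_i=e_i\text{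 for all }1\le i\le s_{k-1}\text{ and all }s_k+1\le i\le s\}$. Put $\Sigma'(n;q)=\Sigma_2\sqcup\cdots\sqcup\Sigma_t$ and $\Sigma''(n;q)=\Sigma(n;q)\setminus\Sigma'(n;q)$.
   Formalization: In (3), |Σ'|=Σ_{k=1}^t|Σ_k| is replaced by |Σ'|+max(t−2,0)=Σ_{k=2}^t|Σ_k|, with Σ' the plain union, since all Σ_k share the element y=(e_1,…,e_s), x=0; in (4), for t=1, where |Σ''| is odd, the exponent |Σ''|/2 is rounded down. *)

(* Defs.v *)
From mathcomp Require Import all_boot all_algebra.
From mathcomp Require Import cyclic.

Set Implicit Arguments.
Unset Strict Implicit.
Unset Printing Implicit Defensive.

Import GRing.Theory.

Lemma ord_mod_subproof (N q : nat) :
  exists k, (0 < k) && (coprime q N ==> (q ^ k == 1 %[mod N])).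
Proof.
have [cqN|] := boolP (coprime q N); last by exists 1.
have [N0|N_gt0] := posnP N.
  by exists 1; move: cqN; rewrite N0 /coprime gcdn0 => /eqP->.
by exists (totient N); rewrite totient_gt0 N_gt0 /= Euler_exp_totient.
Qed.

(* The multiplicative order of q modulo N: the least k > 0 with q ^ k = 1
   modulo N, so that ord_mod 1 q = 1 (junk value 1 if q is not prime to N). *)
Definition ord_mod (N q : nat) : nat := ex_minn (ord_mod_subproof N q).

(* Indices are 0-based: i : 'I_s stands for the prime number i + 1. *)
Section Sigma.
Variables (s : nat) (p e : 'I_s -> nat) (q : nat).

Definition ford (i : 'I_s) (y : nat) : nat := ord_mod (p i ^ (e i - y)) q.

Definition phi (i : 'I_s) (y : nat) : nat := totient (p i ^ (e i - y)).

(* The quotient is exact, as ford i y divides phi i y. *)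
Definition gidx (i : 'I_s) (y : nat) : nat := phi i y %/ ford i y.

Definition exps : finType := {dffun forall i : 'I_s, 'I_(e i).+1}.

(* For the first index the lcm is empty, i.e. 1, and so is the gcd. *)
Definition xbound (y : exps) (i : 'I_s) : nat :=
  gidx i (y i) *
    gcdn (\big[lcmn/1]_(j < s | j < i) ford j (y j)) (ford i (y i)).

(* Sigma(n;q) is the type of all pairs (y, x) with 0 <= y_i <= e_i and
   0 <= x_i < xbound y i. *)
Definition Sigma : finType :=
  {y : exps & {dffun forall i : 'I_s, 'I_(xbound y i)}}.

Definition exps_of (z : Sigma) : exps := tag z.

Variables (b : nat -> nat) (t : nat).

(* b k is the boundary s_k, with b 0 = s_0 = 0. *)
Definition in_block (k : nat) (i : 'I_s) : bool := b k.-1 <= i < b k.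

(* The common 2-adic valuation on the k-th block is w k. The first block,
   of valuation 0, may be empty; all the others are not. *)
Definition grouping : Prop :=
  [/\ 0 < t, b 0 = 0, b t = s, (forall k, 0 < k < t -> b k < b k.+1) &
      exists w : nat -> nat,
        [/\ w 1 = 0, (forall k, 0 < k < t -> w k < w k.+1) &
            forall k (i : 'I_s), 0 < k <= t -> in_block k i ->
              logn 2 (ord_mod (p i) q) = w k]].

Definition Sigma_block (k : nat) : {set Sigma} :=
  [set z | [forall i, ~~ in_block k i ==> (exps_of z i == e i :> nat)]].

(* The blocks Sigma_block k are not disjoint: they all contain the one
   element with y_i = e_i for all i. *)
Definition Sigma' : {set Sigma} := \bigcup_(2 <= k < t.+1) Sigma_block k.

Definition Sigma'' : {set Sigma} := [set: Sigma] :\: Sigma'.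

End Sigma.

Section Codes.
Variables (F : finFieldType) (m : nat).
Implicit Type C : {set 'rV[F]_m}.
Local Open Scope ring_scope.

Definition linear_code C : bool :=
  (0 \in C) && [forall a : F, forall u in C, forall w in C, a *: u + w \in C].

Definition cyclic_shift (u : 'rV[F]_m) : 'rV[F]_m :=
  \row_i u 0 (ord_pred i).

Definition cyclic_code C : bool :=
  linear_code C && [forall u in C, cyclic_shift u \in C].

Definition dual_code C : {set 'rV[F]_m} :=
  [set u : 'rV[F]_m | [forall w in C, \sum_i u 0 i * w 0 i == 0]].

Definition self_dual C : bool := C == dual_code C.

Definition self_dual_cyclic_codes : {set {set 'rV[F]_m}} :=
  [set C | cyclic_code C & self_dual C].

End Codes.

(* Main.v *)
(* Over an extension of F with a primitive n-th root of unity z, the polynomial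
   X^m - 1 is the product of the (X - z^i)^(2^v), i in Z/n.  A cyclic code is the
   set of multiples of a divisor of X^m - 1, so it is determined by the
   multiplicities mu(i) <= 2^v of its generator at the z^i; the functions mu which
   occur are those invariant under i |-> q i, and passing to the dual code
   replaces mu(i) by 2^v - mu(-i).  Self-dual cyclic codes are therefore the
   invariant functions with mu(i) + mu(-i) = 2^v: a free value in {0, ..., 2^v}
   for each pair of distinct opposite q-orbits, and 2^(v-1) on each orbit equal to
   its opposite.  The orbits of the i with gcd(i, n) = prod p_i^(y_i) have length
   the order of q modulo d = prod p_i^(e_i - y_i), so there are
   phi(d) / ord_d(q) = prod xbound_i of them, the number of elements of
   Sigma(n;q) above y.  They are equal to their opposites iff d divides some
   q^k + 1, which holds iff the orders of q modulo the p_i dividing d have the same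
   positive 2-adic valuation, i.e. iff (y, x) lies in some Sigma_k with k >= 2
   (or d = 1). *)

From HB Require Import structures.
Require Import Defs.
From mathcomp Require Import all_boot all_algebra all_field.
From mathcomp Require Import cyclic.

Set Implicit Arguments.
Unset Strict Implicit.
Unset Printing Implicit Defensive.

Import GRing.Theory.

(** * Multiplicative orders *)

Lemma ord_mod_gt0 N q : 0 < ord_mod N q.
Proof. by rewrite /ord_mod; case: ex_minnP => k /andP[]. Qed.

Lemma dvdn_ord_mod N q k :
  coprime q N -> (ord_mod N q %| k) = (q ^ k == 1 %[mod N]).
Proof.
move=> cqN; rewrite /ord_mod; case: ex_minnP => f /andP[f_gt0].
rewrite cqN /= => /eqP qf1 f_min.
have qfM j : q ^ (j * f) = 1 %[mod N].
  by rewrite mulnC expnM -modnXm qf1 modnXm exp1n.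
apply/idP/idP => [/dvdnP[j ->]|]; first by rewrite qfM.
rewrite {1}(divn_eq k f) expnD -modnMml qfM modnMml mul1n => qk1.
rewrite /dvdn; apply/eqP; case: (posnP (k %% f)) => // k_gt0.
by have := f_min (k %% f); rewrite k_gt0 qk1 leqNgt ltn_mod f_gt0 => /(_ isT).
Qed.

Lemma dvdn_ord_mod_sub N q k :
  0 < q -> coprime q N -> (ord_mod N q %| k) = (N %| q ^ k - 1).
Proof.
by move=> q_gt0 cqN; rewrite dvdn_ord_mod // eqn_mod_dvd // expn_gt0 q_gt0.
Qed.

Lemma ord_mod_dvd_totient N q : coprime q N -> ord_mod N q %| totient N.
Proof.
by move=> cqN; rewrite dvdn_ord_mod // Euler_exp_totient.
Qed.

Lemma dvdn_prod_coprime (I : finType) (d : I -> nat) k :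
    (forall i j, i != j -> coprime (d i) (d j)) ->
  (\prod_i d i %| k) = [forall i, d i %| k].
Proof.
move=> co_d; have dvdP r : uniq r -> (\prod_(i <- r) d i %| k) = all (fun i => d i %| k) r.
  elim: r => [|i r IHr] /=; first by rewrite big_nil dvd1n.
  case/andP=> ri /IHr{}IHr; rewrite big_cons Gauss_dvd ?IHr //.
  rewrite big_seq; apply: (big_ind (coprime (d i))); rewrite ?coprimen1 //.
    by move=> x y cx cy; rewrite coprimeMr cx.
  by move=> j rj; apply: co_d; apply: contraNneq ri => ->.
rewrite dvdP ?index_enum_uniq //; apply/allP/forallP => [H i|H i _]; last exact: H.
by rewrite H ?mem_index_enum.
Qed.

(** The two numbers have the same multiples: an exponent k is a multiple of either one iff every
    [d i] divides [q ^ k - 1]. *)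
Lemma ord_mod_prod (I : finType) (d : I -> nat) q :
    0 < q -> (forall i, coprime q (d i)) ->
    (forall i j, i != j -> coprime (d i) (d j)) ->
  ord_mod (\prod_i d i) q = \big[lcmn/1]_i ord_mod (d i) q.
Proof.
move=> q_gt0 cqd co_d.
have cqP : coprime q (\prod_i d i).
  by apply: (big_ind (coprime q)); rewrite ?coprimen1 // => x y cx cy; rewrite coprimeMr cx.
have eq_dvd k : (ord_mod (\prod_i d i) q %| k) = (\big[lcmn/1]_i ord_mod (d i) q %| k).
  rewrite dvdn_ord_mod_sub // dvdn_prod_coprime //.
  apply/forallP/dvdn_biglcmP => [H i _|H i].
    by rewrite dvdn_ord_mod_sub.
  by rewrite -dvdn_ord_mod_sub // H.
by apply/eqP; rewrite eqn_dvd -eq_dvd dvdnn eq_dvd dvdnn.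
Qed.

(** Telescoping of gcd(a, b) lcm(a, b) = a b along the indices. This is what turns the product of
    the bounds on the x_i into phi(d) / ord_d(q). *)
Lemma prod_gcdn_biglcmn s (f : 'I_s -> nat) :
  (\prod_(i < s) gcdn (\big[lcmn/1]_(j < s | j < i) f j) (f i)) * \big[lcmn/1]_i f i
    = \prod_i f i.
Proof.
elim: s f => [|s IHs] f; first by rewrite !big_ord0.
rewrite !big_ord_recr /= -(IHs (fun i => f (widen_ord (leqnSn s) i))).
rewrite (eq_bigr (fun i : 'I_s => gcdn
   (\big[lcmn/1]_(j < s | j < i) f (widen_ord (leqnSn s) j))
   (f (widen_ord (leqnSn s) i)))); last first.
  move=> i _; congr gcdn; rewrite big_mkcond big_ord_recr /= ltnNge ltnW //= lcmn1.
  by rewrite -big_mkcond.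
rewrite [X in gcdn X]big_mkcond big_ord_recr /= ltnn lcmn1.
under [X in gcdn X]eq_bigr => i _ do rewrite ltn_ord.
by rewrite -!mulnA; congr (_ * _); rewrite mulnC muln_lcm_gcd.
Qed.

Lemma dvdn_add1_sub1 p z : prime p -> odd p -> 0 < z ->
  p %| z - 1 -> ~~ (p %| z + 1).
Proof.
move=> p_pr p_odd z_gt0 pz.
have -> : z + 1 = z - 1 + 2 by rewrite addn2 !addn1 subn1 prednK.
by rewrite dvdn_addr // dvdn_prime2 //; apply: contraL p_odd => /eqP->.
Qed.

(** An odd prime divides at most one of z - 1 and z + 1, so that factor absorbs the whole power of
    p. *)
Lemma dvdn_sqr_eq1 p a z : prime p -> odd p -> 0 < z ->
  p ^ a %| z ^ 2 - 1 -> (p ^ a %| z - 1) || (p ^ a %| z + 1).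
Proof.
move=> p_pr p_odd z_gt0; rewrite (subn_sqr z 1).
have [pz|pz] := boolP (p %| z - 1); last first.
  by rewrite Gauss_dvdr ?coprimeXl ?prime_coprime // => ->; rewrite orbT.
rewrite Gauss_dvdl => [-> //|]; rewrite coprimeXl // prime_coprime //.
exact: dvdn_add1_sub1.
Qed.

(** With f the order, q^(f/2) is a square root of 1 modulo p^a, hence 1 or -1, and 1 is excluded by
    the minimality of f. *)
Lemma dvdn_exp_half_add1 p a q : prime p -> odd p -> 0 < q -> coprime q p ->
    ~~ odd (ord_mod (p ^ a) q) ->
  p ^ a %| q ^ (ord_mod (p ^ a) q)./2 + 1.
Proof.
move=> p_pr p_odd q_gt0 cqp ev_f; set f := ord_mod _ _.
have cqpa : coprime q (p ^ a) by rewrite coprimeXr.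
have f_gt0 : 0 < f by apply: ord_mod_gt0.
have fE : f = f./2 * 2 by rewrite muln2 halfK (negPf ev_f) subn0.
have := dvdnn f; rewrite {2}fE dvdn_ord_mod_sub // expnM.
have z_gt0 : 0 < q ^ f./2 by rewrite expn_gt0 q_gt0.
case/(dvdn_sqr_eq1 p_pr p_odd z_gt0)/orP => //.
have h_gt0 : 0 < f./2 by move: f_gt0; rewrite {1}fE muln_gt0 => /andP[].
rewrite -dvdn_ord_mod_sub // -/f => /(dvdn_leq h_gt0).
by rewrite {1}fE leqNgt ltn_Pmulr.
Qed.

(** The order modulo p divides the order f modulo p^a. If the quotient were even, q^(f/2) would be 1
    modulo p, whereas it is -1. *)
Lemma logn2_ord_mod_expn p a q : prime p -> odd p -> 0 < q -> coprime q p ->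
  0 < a -> logn 2 (ord_mod (p ^ a) q) = logn 2 (ord_mod p q).
Proof.
move=> p_pr p_odd q_gt0 cqp a_gt0.
have cqpa : coprime q (p ^ a) by rewrite coprimeXr.
set f := ord_mod _ q; set g := ord_mod p q.
have f_gt0 : 0 < f by apply: ord_mod_gt0.
have g_gt0 : 0 < g by apply: ord_mod_gt0.
have /dvdnP[c fE] : g %| f.
  rewrite dvdn_ord_mod_sub // (dvdn_trans (dvdn_exp a_gt0 (dvdnn p))) //.
  by rewrite -dvdn_ord_mod_sub.
have c_gt0 : 0 < c by move: f_gt0; rewrite fE muln_gt0 => /andP[].
suff odd_c : odd c by rewrite fE lognM // (@lognE 2 c) /= dvdn2 odd_c /= andbF.
apply: contraT => ev_c.
have ev_f : ~~ odd f by rewrite fE oddM negb_and ev_c.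
have := dvdn_exp_half_add1 p_pr p_odd q_gt0 cqp ev_f; rewrite -/f => pf.
have /negP[] : ~~ (p %| q ^ f./2 + 1).
  apply: dvdn_add1_sub1; rewrite ?expn_gt0 ?q_gt0 //.
  rewrite -dvdn_ord_mod_sub // -/g fE.
  by rewrite -(even_halfK ev_c) -doubleMl doubleK dvdn_mull.
exact: dvdn_trans (dvdn_exp a_gt0 (dvdnn p)) pf.
Qed.

(** Passing from k to k + 2 multiplies x^k + 1 by x^2 and subtracts x^2 - 1, a multiple of x + 1. *)
Lemma dvdn_add1_exp_odd x k : odd k -> x + 1 %| x ^ k + 1.
Proof.
case: (posnP x) => [-> _|x_gt0]; first exact: dvd1n.
move=> odd_k; rewrite -(odd_double_half k) odd_k add1n expnS -mul2n mulnC expnM.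
elim: (k./2) => [|j IHj]; first by rewrite mul1n.
have -> : (x ^ 2) ^ j.+1 * x + 1 = ((x ^ 2) ^ j * x + 1) * x ^ 2 - (x ^ 2 - 1).
  rewrite expnSr mulnAC mulnDl mul1n; set y := _ * x ^ 2.
  by rewrite subnBA ?expn_gt0 ?x_gt0 // addnAC addnK.
by rewrite dvdn_sub ?dvdn_mulr // (subn_sqr _ 1) dvdn_mull.
Qed.

(** The order divides 2k but not k, so it contains exactly one more factor 2 than k. *)
Lemma logn2_ord_mod_add1 p k q : prime p -> odd p -> 0 < q -> coprime q p ->
  p %| q ^ k + 1 -> logn 2 (ord_mod p q) = (logn 2 k).+1.
Proof.
move=> p_pr p_odd q_gt0 cqp pk.
set f := ord_mod p q.
have f_gt0 : 0 < f by apply: ord_mod_gt0.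
have Nfk : ~~ (f %| k).
  rewrite dvdn_ord_mod_sub //; apply: contraL pk.
  by apply: dvdn_add1_sub1; rewrite ?expn_gt0 ?q_gt0.
have k_gt0 : 0 < k by case: k Nfk {pk} => //; rewrite dvdn0.
have f2k : f %| k * 2.
  by rewrite dvdn_ord_mod_sub // expnM (subn_sqr _ 1) dvdn_mull.
apply/eqP; rewrite eqn_leq; apply/andP; split.
  have /(dvdn_leq_log 2) := f2k; rewrite lognM // muln_gt0 k_gt0 => /(_ isT).
  by rewrite addn1.
rewrite ltnNge; apply: contra Nfk => le_fk.
(* If v_2(f) <= v_2(k), the 2-part of f divides k, and so does its odd part, which divides 2k; hence
   f would divide k. *)
have {1}-> : f = 2 ^ logn 2 f * f`_2^'.
  by rewrite -p_part partnC.
rewrite Gauss_dvd; last first.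
  by apply: coprimeXl; rewrite coprime2n -[odd _]negbK -dvdn2 -p'natE // part_pnat.
rewrite pfactor_dvdn // le_fk /=.
rewrite -(@Gauss_dvdl _ _ 2); first exact: dvdn_trans (dvdn_part _ _) f2k.
by rewrite coprime_sym coprime2n -[odd _]negbK -dvdn2 -p'natE // part_pnat.
Qed.

(** The arithmetic criterion for an orbit to be its own opposite. A solution k forces the valuation
    v_2(k) + 1 on every order concerned; conversely a common positive valuation allows one exponent
    to serve all the prime powers. *)
Lemma dvdn_expn_add1P (I : finType) (p a : I -> nat) q :
    (forall i, prime (p i)) -> (forall i, odd (p i)) -> injective p ->
    0 < q -> (forall i, coprime q (p i)) ->
  (exists k, \prod_i p i ^ a i %| q ^ k + 1) <->
  (exists2 w, 0 < w & forall i, 0 < a i -> logn 2 (ord_mod (p i) q) = w).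
Proof.
move=> p_pr p_odd p_inj q_gt0 cqp.
have co_p i j : i != j -> coprime (p i ^ a i) (p j ^ a j).
  move=> ij; apply: coprimeXl; apply: coprimeXr.
  by rewrite prime_coprime // dvdn_prime2 // (inj_eq p_inj).
have cqpa i : coprime q (p i ^ a i) by rewrite coprimeXr.
split=> [[k dk]|[w w_gt0 wP]].
  exists (logn 2 k).+1 => // i a_gt0; apply: logn2_ord_mod_add1 => //.
  move: dk; rewrite dvdn_prod_coprime // => /forallP/(_ i).
  exact/dvdn_trans/(dvdn_exp a_gt0 (dvdnn _)).
pose f i := ord_mod (p i ^ a i) q.
have f_gt0 i : 0 < f i by apply: ord_mod_gt0.
(* When [0 < a i], half the order [f i] has 2-part 2^(w-1), so K is an odd multiple of it. *)
pose K := 2 ^ w.-1 * \prod_i (f i)`_2^'.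
exists K; rewrite dvdn_prod_coprime //; apply/forallP => i.
case: (posnP (a i)) => [->|a_gt0]; first exact: dvd1n.
have fw : logn 2 (f i) = w by rewrite /f logn2_ord_mod_expn ?wP.
have fE : (f i)./2 = 2 ^ w.-1 * (f i)`_2^'.
  by rewrite -{1}[f i](partnC 2) // p_part fw -(prednK w_gt0) expnS -mulnA mul2n doubleK.
have ev_f : ~~ odd (f i).
  by rewrite -dvdn2; move: w_gt0; rewrite -fw lognE /=; case: (2 %| f i); rewrite ?andbF.
apply: dvdn_trans (dvdn_exp_half_add1 (p_pr i) (p_odd i) q_gt0 (cqp i) ev_f) _.
rewrite -/(f i) fE /K (bigD1 i) //= mulnA [in X in _ %| X]expnM.
apply: dvdn_add1_exp_odd; apply: (big_ind odd) => // [x y ox oy|j _]; first by rewrite oddM ox.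
by rewrite -[odd _]negbK -dvdn2 -p'natE // part_pnat.
Qed.

(** * Orbits of a permutation commuting with an involution *)

(** [nu] induces an involution on the orbits, each represented by its root. The set keeps, from each
    pair of distinct exchanged orbits, the root that comes first in the enumeration. *)
Lemma half_card_involution_roots (T : finType) (f nu : T -> T) (injf : injective f)
    (nuK : involutive nu) (nuf : forall x, nu (f x) = f (nu x)) :
  #|[set x | froots f x & enum_rank x < enum_rank (froot f (nu x))]|.*2
    = fcard f [pred x | ~~ fconnect f x (nu x)].
Proof.
have symf := fconnect_sym injf.
have nu_iter k x : nu (iter k f x) = iter k f (nu x).
  by elim: k => //= k IHk; rewrite nuf IHk.
have nu_con x y : fconnect f x y -> fconnect f (nu x) (nu y).
  by move=> /iter_findex <-; rewrite nu_iter fconnect_iter.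
pose r x := froot f (nu x).
have rK x : froots f x -> r (r x) = x.
  move=> /eqP rx; rewrite /r -[RHS]rx; apply/eqP; rewrite root_connect //.
  by rewrite symf -{1}(nuK x); apply: nu_con; apply: connect_root.
have froots_r x : froots f (r x) by apply: roots_root.
set A := [set x | _ & _].
(* The roots left out of each pair: [r] exchanges A and B. *)
pose B := [set x | froots f x & enum_rank (r x) < enum_rank x].
have cAB : #|A| = #|B|.
  have AB : {in A, forall x, r x \in B}.
    by move=> x; rewrite !inE => /andP[fx lx]; rewrite froots_r rK.
  have BA : {in B, forall x, r x \in A}.
    by move=> x; rewrite !inE => /andP[fx lx]; rewrite froots_r -/(r _) rK.
  have injr : {in froots f &, injective r}.
    by move=> x y fx fy rxy; rewrite -(rK x fx) rxy rK.
  apply/eqP; rewrite eqn_leq; apply/andP; split.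
    rewrite -(@card_in_imset _ _ r A); last first.
      by move=> x y; rewrite !inE => /andP[fx _] /andP[fy _]; apply: injr.
    by apply: subset_leq_card; apply/subsetP => _ /imsetP[x xA ->]; apply: AB.
  rewrite -(@card_in_imset _ _ r B); last first.
    by move=> x y; rewrite !inE => /andP[fx _] /andP[fy _]; apply: injr.
  by apply: subset_leq_card; apply/subsetP => _ /imsetP[x xA ->]; apply: BA.
rewrite -addnn {2}cAB -cardsUI.
have -> : A :&: B = set0.
  apply/setP => x; rewrite !inE -/(r x).
  by case: ltngtP; rewrite ?andbF.
rewrite cards0 addn0; apply: eq_card => x; rewrite !inE -/(r x).
rewrite -andb_orr -neq_ltn; apply: andb_id2l => /eqP fx.
rewrite -(root_connect symf) -/(r x) fx; congr (~~ _).
by rewrite -(inj_eq enum_rank_inj).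
Qed.

(* An orbit different from its image carries an arbitrary value, which
   determines the value on the image; an orbit equal to its image carries N / 2. *)
Lemma card_involution_functions (T : finType) (f nu : T -> T) (N : nat) :
    injective f -> involutive nu -> (forall x, nu (f x) = f (nu x)) -> ~~ odd N ->
  #|[set mu : {ffun T -> 'I_N.+1} |
      [forall x, (mu (f x) == mu x) && (mu x + mu (nu x) == N)]]|
    = N.+1 ^ (fcard f [pred x | ~~ fconnect f x (nu x)])./2.
Proof.
move=> injf nuK nuf /even_halfK; move: (N./2) => h <- {N}.
rewrite -half_card_involution_roots // doubleK.
set M := [set mu : {ffun _} | _]; set A := [set x | _ & _].
have symf := fconnect_sym injf.
have nu_iter k x : nu (iter k f x) = iter k f (nu x).
  by elim: k => //= k IHk; rewrite nuf IHk.
have rootf x : froot f (f x) = froot f x.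
  by apply/eqP; rewrite root_connect // symf fconnect1.
have root_nu x : froot f (nu (froot f x)) = froot f (nu x).
  apply/eqP; rewrite root_connect // symf.
  by have /iter_findex <- := connect_root (frel f) x; rewrite nu_iter fconnect_iter.
have MP (mu : {ffun T -> 'I_(h.*2).+1}) : reflect ((forall x, mu (froot f x) = mu x) /\
                      (forall x, mu x + mu (nu x) = h.*2)) (mu \in M).
  rewrite inE; apply: (iffP forallP) => [H|[H1 H2] x]; last first.
    by rewrite -(H1 (f x)) rootf H1 eqxx H2 eqxx.
  split=> x; last by have /andP[_ /eqP] := H x.
  have /iter_findex <- := connect_root (frel f) x.
  by elim: (findex _ _ _) => //= k <-; have /andP[/eqP] := H (iter k f x).
(* A solution is recovered from its values on the chosen roots A, so solutions are counted by these
   restrictions, extended by the default 0. *)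
pose res (mu : {ffun T -> 'I_(h.*2).+1}) : {ffun T -> 'I_(h.*2).+1} :=
  [ffun x => if x \in A then mu x else ord0].
have -> : #|M| = #|res @: M|.
  rewrite card_in_imset // => mu1 mu2 /MP[mu1r mu1n] /MP[mu2r mu2n] /ffunP eq_res.
  have eqA x : x \in A -> mu1 x = mu2 x.
    by move=> xA; have := eq_res x; rewrite !ffunE xA.
  apply/ffunP => x; apply: val_inj => /=.
  rewrite -(mu1r x) -(mu2r x); have: froots f (froot f x) by apply: roots_root.
  move: (froot f x) => {}x fx.
  case: (ltngtP (enum_rank x) (enum_rank (froot f (nu x)))) => [lt|gt|eq].
  - by rewrite eqA // inE fx.
  - have yA : froot f (nu x) \in A.
      by rewrite inE roots_root // root_nu nuK (eqP fx).
    apply/eqP; rewrite -(eqn_add2r (mu1 (nu x))) mu1n -(mu1r (nu x)) (eqA _ yA) mu2r.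
    by rewrite mu2n.
  - have xE : x = froot f (nu x) by apply: enum_rank_inj; apply: val_inj.
    have mu1x := mu1n x; have mu2x := mu2n x.
    rewrite -(mu1r (nu x)) -xE addnn in mu1x; rewrite -(mu2r (nu x)) -xE addnn in mu2x.
    by rewrite (double_inj mu1x) (double_inj mu2x).
transitivity #|pffun_on (ord0 : 'I_(h.*2).+1) A predT|; last first.
  by rewrite card_pffun_on card_ord.
apply: eq_card => g; apply/imsetP/pffun_onP => [[mu _ ->]|[/subsetP sgA _]].
  split=> //; apply/subsetP => x; rewrite !inE ffunE -/A.
  by case: ifP; rewrite ?eqxx // inE.
(* The value is free on an orbit with root in A and forced on the opposite orbit; every other orbit
   is its own opposite and gets the middle value h. *)
pose mu : {ffun T -> 'I_(h.*2).+1} :=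
  [ffun x => let r := froot f x in let r' := froot f (nu x) in
     if r \in A then g r else if r' \in A then inord (h.*2 - g r') else inord h].
have gA x : x \notin A -> g x = ord0.
  by move=> xA; apply/eqP; apply: contraR xA => xA; apply: sgA; rewrite inE.
have le2h (k : 'I_(h.*2).+1) : k <= h.*2 by rewrite -ltnS.
have notboth x : froot f x \in A -> froot f (nu x) \in A -> False.
  rewrite !inE !root_nu nuK => /andP[_ lt1] /andP[_ lt2].
  by have := ltn_trans lt1 lt2; rewrite ltnn.
exists mu; last first.
  apply/ffunP => x; rewrite !ffunE; case: ifPn => [|/gA //] xA.
  have rx : froot f x = x by move: (xA); rewrite inE => /andP[/eqP].
  by rewrite /= rx xA.
apply/MP; split=> x.
  by rewrite !ffunE root_root // root_nu.
rewrite !ffunE /= nuK; case: ifPn => xA; case: ifPn => yA.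
- by case: (notboth x).
- by rewrite inordK ?ltnS ?leq_subr // subnKC.
- by rewrite inordK ?ltnS ?leq_subr // subnK.
- by rewrite inordK ?addnn // -addnn ltnS leq_addr.
Qed.

(** * Cyclotomic orbits and exponent vectors *)

Lemma dvdn_mul_gcd n c d x z : 0 < c -> n = c * d -> gcdn x n = c ->
  (n %| x * z) = (d %| z).
Proof.
move=> c_gt0 -> gx; have /dvdnP[x' xE] : c %| x by rewrite -gx dvdn_gcdl.
have co : coprime d x'.
  move/eqP: gx; rewrite xE mulnC -muln_gcdr -{2}[c]muln1 eqn_pmul2l //.
  by rewrite gcdnC.
by rewrite xE (mulnC x') -mulnA dvdn_pmul2l // Gauss_dvdr.
Qed.

(** Multiplication by c is a bijection from the k < d prime to d onto these residues. *)
Lemma card_gcd_eq c d n : 0 < c -> n = c * d ->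
  #|[set x : 'I_n | gcdn x n == c]| = totient d.
Proof.
move=> c_gt0 nE; rewrite totient_count_coprime big_mkord.
have lt_cn (k : 'I_d) : c * k < n by rewrite nE ltn_pmul2l.
pose g k := Ordinal (lt_cn k).
have injg : injective g.
  by move=> k l /(congr1 val)/= /eqP; rewrite eqn_pmul2l // => /eqP/val_inj.
rewrite (eq_bigr (fun k : 'I_d => if coprime d k then 1 else 0)); last first.
  by move=> k _; case: coprime.
rewrite -big_mkcond sum1dep_card -(card_imset _ injg); apply: eq_card => x.
rewrite !inE; apply/eqP/imsetP => [gx|[k]].
  have /dvdnP[k xE] : c %| x by rewrite -gx dvdn_gcdl.
  have lt_kd : k < d by have := ltn_ord x; rewrite {2}nE xE mulnC ltn_pmul2l.
  exists (Ordinal lt_kd); last by apply: val_inj => /=; rewrite xE mulnC.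
  rewrite inE /= /coprime gcdnC -(eqn_pmul2l c_gt0) muln_gcdr muln1 -nE mulnC -xE.
  by rewrite gx.
by rewrite inE => /eqP co -> /=; rewrite nE -muln_gcdr gcdnC co muln1.
Qed.

Section CyclotomicOrbits.
Variables (n q : nat).
Hypothesis co_qn : coprime q n.+1.
Hypothesis q_gt0 : 0 < q.

(** Its orbits are the q-cyclotomic classes. The modulus is written [n.+1] so that ['I_n.+1] carries
    the additive group of Z/(n+1). *)
Definition Zp_scale (x : 'I_n.+1) : 'I_n.+1 := (x *+ q)%R.

Lemma Zp_mulrn_eq0 (x : 'I_n.+1) z : (x *+ z == 0)%R = (n.+1 %| x * z).
Proof. by rewrite Zp_mulrn. Qed.

Lemma Zp_scale_inj : injective Zp_scale.
Proof.
move=> x y /eqP; rewrite -subr_eq0 -mulrnBl Zp_mulrn_eq0 Gauss_dvdl 1?coprime_sym //.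
by rewrite -[X in _ %| X]muln1 -Zp_mulrn_eq0 mulr1n subr_eq0 => /eqP.
Qed.

Lemma Zp_scaleN x : (- Zp_scale x = Zp_scale (- x))%R.
Proof. by rewrite /Zp_scale mulNrn. Qed.

Lemma iter_Zp_scale k x : iter k Zp_scale x = (x *+ (q ^ k))%R.
Proof. by elim: k => //= k ->; rewrite /Zp_scale -mulrnA expnSr. Qed.

Lemma gcdn_Zp_scale (x : 'I_n.+1) : gcdn (Zp_scale x) n.+1 = gcdn x n.+1.
Proof.
rewrite /Zp_scale Zp_mulrn /= gcdn_modl gcdnC Gauss_gcdl 1?coprime_sym //.
exact: gcdnC.
Qed.

(** The k-th iterate fixes x iff c d divides x (q^k - 1), that is, iff d divides q^k - 1, because x
    / c is prime to d. *)
Lemma order_Zp_scale c d (x : 'I_n.+1) : n.+1 = c * d -> gcdn x n.+1 = c ->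
  order Zp_scale x = ord_mod d q.
Proof.
move=> nE gx; have c_gt0 : 0 < c by rewrite -gx gcdn_gt0 orbT.
have co_qd : coprime q d by move: co_qn; rewrite nE coprimeMr => /andP[].
have iterP k : (iter k Zp_scale x == x) = (ord_mod d q %| k).
  rewrite iter_Zp_scale -subr_eq0 -{2}[x]mulr1n -mulrnBr ?expn_gt0 ?q_gt0 //.
  by rewrite Zp_mulrn_eq0 (dvdn_mul_gcd _ c_gt0 nE gx) dvdn_ord_mod_sub.
apply/eqP; rewrite eqn_leq; apply/andP; split; last first.
  by apply: dvdn_leq; rewrite ?order_gt0 // -iterP iter_order //; apply: Zp_scale_inj.
rewrite leqNgt; apply/negP => /findex_iter.
have /eqP-> : iter (ord_mod d q) Zp_scale x == x by rewrite iterP.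
by rewrite findex0 => f0; have := ord_mod_gt0 d q; rewrite -f0.
Qed.

Lemma fconnect_Zp_scaleNP c d (x : 'I_n.+1) : n.+1 = c * d -> gcdn x n.+1 = c ->
  reflect (exists k, d %| q ^ k + 1) (fconnect Zp_scale x (- x)%R).
Proof.
move=> nE gx; have c_gt0 : 0 < c by rewrite -gx gcdn_gt0 orbT.
have iterP k : (iter k Zp_scale x == - x)%R = (d %| q ^ k + 1).
  rewrite iter_Zp_scale -subr_eq0 opprK -{2}[x]mulr1n -mulrnDr.
  by rewrite Zp_mulrn_eq0 (dvdn_mul_gcd _ c_gt0 nE gx).
apply: (iffP idP) => [con|[k]]; last by rewrite -iterP => /eqP <-; apply: fconnect_iter.
by exists (findex Zp_scale x (- x)%R); rewrite -iterP iter_findex.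
Qed.

End CyclotomicOrbits.

Lemma logn_prod_expn (I : finType) (p a : I -> nat) l :
    (forall i, prime (p i)) ->
  logn l (\prod_i p i ^ a i) = \sum_i (l == p i) * a i.
Proof.
move=> p_pr; have pa_gt0 i : 0 < p i ^ a i by rewrite expn_gt0 prime_gt0.
suff [] : 0 < \prod_i p i ^ a i /\ logn l (\prod_i p i ^ a i) = \sum_i (l == p i) * a i by [].
apply: (big_rec2 (fun x y => 0 < x /\ logn l x = y)); first by rewrite logn1.
move=> i x y _ [x_gt0 <-]; rewrite muln_gt0 x_gt0 pa_gt0 lognM //; split=> //.
by rewrite lognX logn_prime // mulnC.
Qed.

(** * Residues grouped by their gcd with the modulus, and fibres of Sigma *)

Section Classes.
Variables (s : nat) (p e : 'I_s -> nat) (q n : nat).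
Hypothesis p_pr : forall i, prime (p i).
Hypothesis p_inj : injective p.
Hypothesis q_gt0 : 0 < q.
Hypothesis co_qp : forall i, coprime q (p i).
Hypothesis nE : n.+1 = \prod_i p i ^ e i.
Implicit Type y : exps e.

Definition class_gcd y : nat := \prod_i p i ^ y i.
Definition class_order y : nat := \prod_i p i ^ (e i - y i).

(** The exponents of the gcd of x with the modulus; they never exceed [e i], so the default value of
    [inord] is not reached. *)
Definition exps_class (x : 'I_n.+1) : exps e :=
  finfun (fun i => inord (logn (p i) (gcdn x n.+1)) : 'I_(e i).+1).

Lemma co_q_order : coprime q n.+1.
Proof.
rewrite nE; apply: (big_ind (coprime q)) => [||i _]; rewrite ?coprimen1 //.
  by move=> x y cx cy; rewrite coprimeMr cx.
by rewrite coprimeXr.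
Qed.

Lemma class_gcd_order y : n.+1 = class_gcd y * class_order y.
Proof.
rewrite nE /class_gcd /class_order -big_split; apply: eq_bigr => i _ /=.
by rewrite -expnD subnKC // -ltnS.
Qed.

Lemma logn_prod_expn_p (a : 'I_s -> nat) i : logn (p i) (\prod_j p j ^ a j) = a i.
Proof.
rewrite logn_prod_expn // (bigD1 i) //= eqxx mul1n big1 ?addn0 // => j ji.
by rewrite (inj_eq p_inj) eq_sym (negPf ji).
Qed.

Lemma exps_classP x y : (exps_class x == y) = (gcdn x n.+1 == class_gcd y).
Proof.
have g_gt0 : 0 < gcdn x n.+1 by rewrite gcdn_gt0 orbT.
have le_log l : logn l (gcdn x n.+1) <= logn l n.+1.
  by apply: dvdn_leq_log; rewrite ?dvdn_gcdr.
have ltlog i : logn (p i) (gcdn x n.+1) < (e i).+1.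
  by rewrite ltnS (leq_trans (le_log _)) // nE logn_prod_expn_p.
apply/eqP/eqP => [<-|gx]; last first.
  by apply/ffunP => i; apply: val_inj; rewrite ffunE /= inordK // gx logn_prod_expn_p.
apply: eqn_from_log => //.
  by rewrite prodn_gt0 // => i; rewrite expn_gt0 prime_gt0.
move=> l; rewrite logn_prod_expn //.
have [i /eqP li|no_i] := pickP (fun i => l == p i).
  rewrite (bigD1 i) //= li eqxx mul1n ffunE inordK // big1 ?addn0 // => j ji.
  by rewrite (inj_eq p_inj) eq_sym (negPf ji).
rewrite big1 => [|i _]; last by rewrite no_i.
apply/eqP; rewrite -leqn0 (leq_trans (le_log _)) // nE logn_prod_expn //.
by rewrite big1 // => i _; rewrite no_i.
Qed.

Lemma coprime_prime_powers (a : 'I_s -> nat) i j : i != j ->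
  coprime (p i ^ a i) (p j ^ a j).
Proof.
move=> ij; apply: coprimeXl; apply: coprimeXr.
by rewrite prime_coprime // dvdn_prime2 // (inj_eq p_inj).
Qed.

Lemma totient_class_order y : totient (class_order y) = \prod_i phi p e i (y i).
Proof.
have H r : uniq r -> totient (\prod_(i <- r) p i ^ (e i - y i))
    = \prod_(i <- r) phi p e i (y i).
  elim: r => [|i r IHr] /=; first by rewrite !big_nil.
  case/andP=> ri /IHr{}IHr; rewrite !big_cons totient_coprime ?IHr //.
  rewrite big_seq; apply: (big_ind (coprime (p i ^ (e i - y i)))); rewrite ?coprimen1 //.
    by move=> u v cu cv; rewrite coprimeMr cu.
  move=> j rj; apply: (coprime_prime_powers (fun i => e i - y i)).
  by apply: contraNneq ri => ->.
exact/H/index_enum_uniq.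
Qed.

Lemma ord_mod_class_order y :
  ord_mod (class_order y) q = \big[lcmn/1]_i ford p e q i (y i).
Proof.
apply: ord_mod_prod => // [i|i j]; first by rewrite coprimeXr.
exact: (coprime_prime_powers (fun i => e i - y i)).
Qed.

Lemma prod_xbound y :
  (\prod_i xbound p q y i) * \big[lcmn/1]_i ford p e q i (y i) =
    \prod_i phi p e i (y i).
Proof.
rewrite big_split -mulnA prod_gcdn_biglcmn -big_split; apply: eq_bigr => i _.
by rewrite /gidx /= divnK // ord_mod_dvd_totient // coprimeXr.
Qed.

(** The class has phi(d) elements and all its orbits have length ord_d(q), for d = [class_order y];
    the two sides are compared after multiplication by that length. *)
Lemma fcard_exps_class y :
  fcard (@Zp_scale n q) [pred x | exps_class x == y] = \prod_i xbound p q y i.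
Proof.
apply/eqP; rewrite -(eqn_pmul2r (ord_mod_gt0 (class_order y) q)).
rewrite {2}ord_mod_class_order prod_xbound -totient_class_order.
rewrite (@fcard_order_set _ _ (Zp_scale_inj co_q_order)).
- rewrite -(card_gcd_eq _ (class_gcd_order y)); last first.
    by rewrite prodn_gt0 // => i; rewrite expn_gt0 prime_gt0.
  by apply/eqP/eq_card => x; rewrite !inE exps_classP.
- apply/subsetP => x; rewrite !inE exps_classP => /eqP gx; apply/eqP.
  exact: (order_Zp_scale co_q_order _ (class_gcd_order y)).
- by move=> x z /eqP <-; rewrite !inE !exps_classP gcdn_Zp_scale // co_q_order.
Qed.

Lemma card_Sigma_pred (Y : pred (exps e)) :
  #|[set z : Sigma p e q | Y (exps_of z)]| = \sum_(y | Y y) \prod_i xbound p q y i.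
Proof.
rewrite -sum1dep_card; under eq_bigl => z do rewrite -[Y _]andbT.
rewrite -(sig_big_dep Y (fun _ => xpredT) (fun _ _ => 1)).
apply: eq_bigr => y _; rewrite sum1_card card_dep_ffun foldrE big_map big_enum /=.
by apply: eq_bigr => i _; rewrite card_ord.
Qed.

(** Orbits and elements of [Sigma] both lie over the exponent vectors, with fibres of equal size, so
    any condition on the vector selects equally many of each. *)
Lemma fcard_exps_class_pred (Y : pred (exps e)) :
  fcard (@Zp_scale n q) [pred x | Y (exps_class x)]
    = #|[set z : Sigma p e q | Y (exps_of z)]|.
Proof.
rewrite card_Sigma_pred /n_comp_mem -sum1_card (partition_big exps_class Y) /=.
  apply: eq_bigr => y Yy; rewrite -fcard_exps_class /n_comp_mem -sum1_card.
  apply: eq_bigl => x; rewrite !inE -andbA; congr (_ && _).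
  by apply/andb_idl => /eqP ->.
by move=> x; rewrite !inE => /andP[].
Qed.

(** The primes dividing [class_order] are the [p i] with y_i different from e_i; the criterion for
    dividing some q^k + 1 is applied to them. *)
Lemma fconnect_exps_classP x : (forall i, odd (p i)) ->
  fconnect (@Zp_scale n q) x (- x)%R <->
  (exists2 w, 0 < w & forall i, exps_class x i != e i :> nat ->
     logn 2 (ord_mod (p i) q) = w).
Proof.
move=> p_odd; set y := exps_class x.
have gx : gcdn x n.+1 = class_gcd y by apply/eqP; rewrite -exps_classP.
have R := fconnect_Zp_scaleNP q (class_gcd_order y) gx.
have [D1 D2] := dvdn_expn_add1P (fun i => e i - y i) p_pr p_odd p_inj q_gt0 co_qp.
have lt_e i : (0 < e i - y i) = (y i != e i :> nat).
  by rewrite subn_gt0 ltn_neqAle -ltnS ltn_ord andbT.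
split=> [/R/D1 [w w_gt0 wP]|[w w_gt0 wP]].
  by exists w => // i; rewrite -lt_e; apply: wP.
by apply/R/D2; exists w => // i; rewrite lt_e; apply: wP.
Qed.

End Classes.

(** * Cardinalities of Sigma and of its subsets *)

Lemma big_sig_pred (R : Type) (idx : R) (op : Monoid.com_law idx) (I : finType)
    (P : pred I) (F : I -> R) :
  \big[op/idx]_(i | P i) F i = \big[op/idx]_(j : {i | P i}) F (val j).
Proof.
rewrite (reindex_omap (val : {i | P i} -> I) insub).
  by apply: eq_bigl => j; rewrite valK (valP j) eqxx.
by move=> i Pi; rewrite insubT.
Qed.

Lemma bigcup_natP (T : finType) m n (A : nat -> {set T}) x :
  reflect (exists2 k, m <= k < n & x \in A k) (x \in \bigcup_(m <= k < n) A k).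
Proof.
rewrite big_geq_mkord; apply: (iffP bigcupP) => [[k mk xA]|[k /andP[mk kn] xA]].
  by exists k; rewrite ?ltn_ord ?andbT.
by exists (Ordinal kn).
Qed.

Lemma ord_mod_1 q : ord_mod 1 q = 1.
Proof.
by apply/eqP; rewrite -dvdn1 dvdn_ord_mod ?coprimen1 // !modn1.
Qed.

Section SigmaCards.
Variables (s : nat) (p e : 'I_s -> nat) (q : nat).
Hypothesis p_pr : forall i, prime (p i).
Hypothesis co_qp : forall i, coprime q (p i).
Implicit Type y : exps e.

Lemma biglcm_ford_gt0 (I : finType) (g : I -> 'I_s) (a : I -> nat) :
  0 < \big[lcmn/1]_i ford p e q (g i) (a i).
Proof.
by apply: (big_ind (leq 1)) => // [x y x0 y0|i _]; rewrite ?lcmn_gt0 ?x0 ?ord_mod_gt0.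
Qed.

Lemma natr_prod_xbound y :
  ((\prod_i xbound p q y i)%:R = (\prod_i phi p e i (y i))%:R /
     (\big[lcmn/1%N]_i ford p e q i (y i))%:R :> rat)%R.
Proof.
rewrite -(prod_xbound co_qp) natrM mulfK // Num.Theory.pnatr_eq0 -lt0n.
exact: (@biglcm_ford_gt0 _ id).
Qed.

Lemma card_SigmaE :
  (#|Sigma p e q|%:R = \sum_(y : exps e)
     (\prod_i phi p e i (y i))%:R / (\big[lcmn/1%N]_i ford p e q i (y i))%:R :> rat)%R.
Proof.
rewrite -cardsT (card_Sigma_pred p q xpredT) natr_sum.
by apply: eq_bigr => y _; apply: natr_prod_xbound.
Qed.

(** An index outside P is frozen at y_i = e_i, where the totient and the order are both 1, so it
    contributes neither to the product nor to the lcm. *)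
Lemma card_Sigma_subset (P : pred 'I_s) :
  (#|[set z : Sigma p e q | [forall i, ~~ P i ==> (exps_of z i == e i :> nat)]]|%:R =
    \sum_(y : {dffun forall i : {i : 'I_s | P i}, 'I_(e (val i)).+1})
      (\prod_i phi p e (val i) (y i))%:R /
      (\big[lcmn/1%N]_i ford p e q (val i) (y i))%:R :> rat)%R.
Proof.
pose Y y := [forall i, ~~ P i ==> (y i == e i :> nat)].
pose sub_exps : finType := {dffun forall i : {i : 'I_s | P i}, 'I_(e (val i)).+1}.
pose ext (y : sub_exps) : exps e :=
  finfun (fun i => inord (if insub i is Some j then y j : nat else e i) : 'I_(e i).+1).
pose res y : sub_exps :=
  finfun (fun j => y (val j)).
have extP (y : sub_exps) j : ext y (val j) = y j.
  by apply: val_inj; rewrite ffunE valK /= inordK.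
have extN (y : sub_exps) i : ~~ P i -> ext y i = e i :> nat.
  by move=> Pi; rewrite ffunE insubN // inordK.
rewrite (card_Sigma_pred p q Y) natr_sum (reindex_onto ext res) => [|y /forallP Yy].
  apply: eq_big => [y|y _].
    apply/andP; split; first by apply/forallP => i; apply/implyP => /extN ->.
    by apply/eqP/ffunP => j; rewrite ffunE extP.
  rewrite natr_prod_xbound; congr (_%:R / _%:R)%R.
    rewrite (bigID P) /= [X in _ * X]big1 ?muln1 => [|i Pi]; last first.
      by rewrite extN // /phi subnn.
    by rewrite big_sig_pred; apply: eq_bigr => j _; rewrite extP.
  rewrite (bigID P) /= [X in lcmn _ X]big1 ?lcmn1 => [|i Pi]; last first.
    by rewrite extN // /ford subnn ord_mod_1.
  by rewrite big_sig_pred; apply: eq_bigr => j _; rewrite extP.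
apply/ffunP => i; have [Pi|Pi] := boolP (P i).
  by rewrite -[i]/(val (Sub i Pi : {i | P i})) extP ffunE.
by apply: val_inj; rewrite /= extN //; have := Yy i; rewrite Pi => /eqP.
Qed.

(** Above y = e the product of the bounds, multiplied by an lcm, equals a product of phi(1) = 1.
    This single element is the one common to all the blocks. *)
Lemma card_Sigma_top :
  #|[set z : Sigma p e q | [forall i, exps_of z i == e i :> nat]]| = 1.
Proof.
pose y0 : exps e := finfun (fun i => ord_max : 'I_(e i).+1).
have topE y : [forall i, y i == e i :> nat] = (y == y0).
  apply/forallP/eqP => [H|-> i]; last by rewrite ffunE.
  by apply/ffunP => i; apply: val_inj; rewrite ffunE; apply/eqP/H.
rewrite (card_Sigma_pred p q (fun y => [forall i, y i == e i :> nat])).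
rewrite (eq_bigl (pred1 y0)) // big_pred1_eq.
have := prod_xbound co_qp y0; rewrite [RHS]big1 => [/eqP|i _].
  by rewrite muln_eq1 => /andP[/eqP].
by rewrite ffunE /phi subnn.
Qed.

(** * Blocks of primes with the same 2-adic valuation of the order *)

Section Grouping.
Variables (b : nat -> nat) (t : nat).
Hypothesis grp : grouping p q b t.

Lemma in_block_ex (i : 'I_s) : exists2 k, 0 < k <= t & in_block b k i.
Proof.
have [t_gt0 b0 bt _ _] := grp.
have ex_k : exists k, i < b k by exists t; rewrite bt.
(* The least k with i < b k: minimality gives b (k - 1) <= i, and b 0 = 0 rules out k = 0. *)
case: (ex_minnP ex_k) => k ik k_min; exists k; last first.
  rewrite /in_block ik andbT leqNgt; apply/negP => /k_min.
  by case: k ik {k_min} => [|k _]; rewrite ?b0 // ltnn.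
rewrite k_min ?bt // andbT; case: k ik {k_min} => //; by rewrite b0.
Qed.

Lemma logn2_in_block : exists w : nat -> nat,
  [/\ w 1 = 0, (forall k l, 0 < k -> k < l <= t -> w k < w l) &
      forall k (i : 'I_s), 0 < k <= t -> in_block b k i ->
        logn 2 (ord_mod (p i) q) = w k].
Proof.
have [_ _ _ _ [w [w1 w_lt wP]]] := grp; exists w; split=> // k l k_gt0 /andP[].
elim: l => // l IHl; rewrite ltnS leq_eqVlt => /predU1P[<- kt|kl lt].
  by rewrite w_lt // k_gt0.
by apply: leq_trans (IHl kl (ltnW lt)) _; rewrite ltnW // w_lt // (leq_trans _ kl).
Qed.

(** Blocks with a common index have the same valuation, and the valuations increase strictly with
    the block. *)
Lemma in_block_inj k l (i : 'I_s) : 0 < k <= t -> 0 < l <= t ->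
  in_block b k i -> in_block b l i -> k = l.
Proof.
have [w [_ w_lt wP]] := logn2_in_block => kt lt bk bl.
have wkl : w k = w l by rewrite -(wP k i) // -(wP l i).
have [k_gt0 le_kt] := andP kt; have [l_gt0 le_lt] := andP lt.
case: (ltngtP k l) => // [kl|lk].
  by have := w_lt k l k_gt0; rewrite kl le_lt wkl ltnn => /(_ isT).
by have := w_lt l k l_gt0; rewrite lk le_kt wkl ltnn => /(_ isT).
Qed.

(** The union is built block by block from the second one on. Each later block meets the union of
    the previous ones in the single element with y = e, which is therefore counted once too
    often. *)
Lemma card_Sigma' :
  #|Sigma' p e q b t| + (t - 2) = \sum_(2 <= k < t.+1) #|Sigma_block p e q b k|.
Proof.
rewrite /Sigma'; have [t_gt0 _ _ _ _] := grp.
have {t_gt0}[t1|t_gt1] : t = 1 \/ 2 <= t by case: (t) t_gt0 => [|[|]]; auto.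
  (* No block is involved, and the truncated difference 1 - 2 is 0. *)
  by rewrite t1 !big_geq // cards0.
suff card_upto j : 2 <= j <= t ->
    #|\bigcup_(2 <= k < j.+1) Sigma_block p e q b k| + (j - 2) =
      \sum_(2 <= k < j.+1) #|Sigma_block p e q b k|.
  by apply: card_upto; rewrite t_gt1 leqnn.
elim: j => // j IHj; rewrite leq_eqVlt.
case/andP=> /predU1P[[<-] _|lt_2j lt_jt].
  by rewrite !big_nat1 addn0.
rewrite ltnS in lt_2j; rewrite !(@big_nat_recr _ _ _ j.+1) 1?ltnW //= -IHj; last first.
  by rewrite lt_2j ltnW.
set U := \bigcup_(2 <= k < j.+1) _; set A := Sigma_block _ _ _ _ _.
have UA : U :&: A = [set z : Sigma p e q | [forall i, exps_of z i == e i :> nat]].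
  apply/setP => z; rewrite in_setI; apply/andP/idP.
    case=> /bigcup_natP[k /andP[le_2k lt_kj]]; rewrite !inE.
    move=> /forallP/= kP /forallP/= jP; apply/forallP => i.
    have [bk|] := boolP (in_block b k i); last exact/implyP/kP.
    have [bj|] := boolP (in_block b j.+1 i); last exact/implyP/jP.
    have kt : 0 < k <= t.
      by rewrite (leq_trans _ le_2k) //= (leq_trans _ lt_jt) // ltnW.
    by have kj := @in_block_inj k j.+1 i kt lt_jt bk bj; rewrite kj ltnn in lt_kj.
  rewrite inE => /forallP zP; split; last first.
    by rewrite inE; apply/forallP => i; rewrite zP implybT.
  apply/bigcup_natP; exists 2; first by rewrite leqnn ltnS.
  by rewrite inE; apply/forallP => i; rewrite zP implybT.
have := cardsUI U A; rewrite UA card_Sigma_top => cUI.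
by rewrite subSn // addnS -addSn -addn1 cUI addnAC.
Qed.

Hypothesis p_odd : forall i, odd (p i).
Hypothesis p_inj : injective p.
Hypothesis q_gt0 : 0 < q.
Variable n : nat.
Hypothesis nE : n.+1 = \prod_i p i ^ e i.

(** The blocks are the level sets of the valuation, and those of index at least 2 are the ones of
    positive valuation. *)
Lemma in_block_logn2P y : 2 <= t ->
  (exists2 k, 2 <= k < t.+1 & [forall i, ~~ in_block b k i ==> (y i == e i :> nat)]) <->
  (exists2 w, 0 < w & forall i, y i != e i :> nat ->
     logn 2 (ord_mod (p i) q) = w).
Proof.
move=> t_gt1; have [w [w1 w_lt wP]] := logn2_in_block; split.
  case=> k /andP[le_2k le_kt] /forallP zP.
  exists (w k); first by rewrite (leq_trans _ (w_lt 1 k isT _)) // le_2k.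
  move=> i zi; apply: wP; first by rewrite (leq_trans _ le_2k).
  by apply: contraR zi => /(implyP (zP i)).
case=> w0 w0_gt0 w0P.
case: (pickP (fun i => y i != e i :> nat)) => [i0 zi0|z_top]; last first.
  (* For y = e every block fits; block 2 is available because 2 <= t. *)
  exists 2; rewrite ?leqnn //; apply/forallP => i; apply/implyP => _.
  by have /negbFE := z_top i.
have [k /andP[k_gt0 le_kt] bk] := in_block_ex i0.
have wk : w k = w0 by rewrite -(wP k i0) ?k_gt0 // w0P.
exists k.
  rewrite ltnS le_kt andbT ltn_neqAle k_gt0 andbT; apply: contraTneq w0_gt0 => k1.
  by rewrite -wk -k1 w1.
apply/forallP => i; apply/implyP; apply: contraR => zi.
have [l lt bl] := in_block_ex i; have wl : w l = w0 by rewrite -(wP l i) // w0P.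
have [l_gt0 le_lt] := andP lt.
case: (ltngtP k l) => [kl|lk|-> //].
  by have := w_lt k l k_gt0; rewrite kl le_lt wk wl ltnn => /(_ isT).
by have := w_lt l k l_gt0; rewrite lk le_kt wk wl ltnn => /(_ isT).
Qed.

(** For t >= 2, [Sigma''] has as many elements as there are orbits different from their opposites;
    these come in pairs, so the number is even. *)
Lemma half_card_Sigma'' :
  (2 <= t -> ~~ odd #|Sigma'' p e q b t|) /\
  (fcard (@Zp_scale n q) [pred x | ~~ fconnect (@Zp_scale n q) x (- x)%R])./2
    = #|Sigma'' p e q b t|./2.
Proof.
have co_qn := co_q_order co_qp nE.
have even_fcard : ~~ odd (fcard (@Zp_scale n q) [pred x | ~~ fconnect (@Zp_scale n q) x (- x)%R]).
  rewrite -half_card_involution_roots ?odd_double //.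
  - exact: Zp_scale_inj.
  - exact: opprK.
  - exact: Zp_scaleN.
have conP x := fconnect_exps_classP p_pr p_inj q_gt0 co_qp nE x p_odd.
have fcardE := fcard_exps_class_pred p_pr p_inj q_gt0 co_qp nE.
have [t_gt0 _ _ _ _] := grp.
have {t_gt0}[t1|t_gt1] : t = 1 \/ 2 <= t by case: (t) t_gt0 => [|[|]]; auto.
  split; first by rewrite t1.
  (* For t = 1 all the orders are odd, so only the orbit of 0 is its own opposite, while [Sigma'']
     is all of [Sigma]. The extra element disappears when the half is rounded down. *)
  have -> : #|Sigma'' p e q b t| =
      (fcard (@Zp_scale n q) [pred x | ~~ fconnect (@Zp_scale n q) x (- x)%R]).+1; last first.
    by rewrite /= uphalf_half (negPf even_fcard) add0n.
  have [w [w1 w_lt wP]] := logn2_in_block.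
  rewrite (@eq_n_comp_r _ _ _ [pred x | [exists i, exps_class p e x i != e i :> nat]]).
    rewrite (fcardE (fun y => [exists i, y i != e i :> nat])).
    rewrite /Sigma'' /Sigma' t1 big_geq // setD0 cardsT -(cardsC
      [set z : Sigma p e q | [forall i, exps_of z i == e i :> nat]]) card_Sigma_top add1n.
    by congr _.+1; apply: eq_card => z; rewrite !inE negb_forall.
  move=> x; rewrite !inE; apply/idP/existsP => [/negP Ncon|[i xi]].
    apply/existsP; rewrite -negb_forall; apply/negP => /forallP xP; apply: Ncon.
    by apply/conP; exists 1 => // i; rewrite xP.
  apply/negP => /conP[w0 w0_gt0 /(_ i xi)].
  have [k] := in_block_ex i; rewrite t1; case: k => [|[|]] // _ bi.
  by rewrite (wP 1) ?t1 // w1 => w00; rewrite -w00 in w0_gt0.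
pose Y y := [exists k : 'I_t.+1, (2 <= k) && [forall i, ~~ in_block b k i ==> (y i == e i :> nat)]].
have YP y : Y y <-> exists2 k, 2 <= k < t.+1 &
    [forall i, ~~ in_block b k i ==> (y i == e i :> nat)].
  split=> [/existsP[k /andP[le_2k kP]]|[k /andP[le_2k lt_kt] kP]].
    by exists k; rewrite ?le_2k ?ltn_ord.
  by apply/existsP; exists (Ordinal lt_kt); rewrite /= le_2k.
have -> : #|Sigma'' p e q b t| =
    fcard (@Zp_scale n q) [pred x | ~~ fconnect (@Zp_scale n q) x (- x)%R]; last by [].
rewrite (@eq_n_comp_r _ _ _ [pred x | ~~ Y (exps_class p e x)]).
  rewrite (fcardE (fun y => ~~ Y y)); apply: eq_card => z.
  rewrite in_setD in_setT andbT [in RHS]inE; congr (~~ _).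
  apply/bigcup_natP/idP => [[k kt]|/YP[k kt kP]].
    by rewrite inE => kP; apply/YP; exists k.
  by exists k; rewrite // inE.
move=> x; rewrite !inE; congr (~~ _); apply/idP/idP => [/conP/in_block_logn2P|].
  by move=> /(_ t_gt1)/YP.
by move=> /YP/in_block_logn2P-/(_ t_gt1)/conP.
Qed.

End Grouping.
End SigmaCards.

(** * Cyclic codes as ideals, and duality *)

Section CyclicCodeIdeals.
Variables (F : finFieldType) (m' : nat).
Local Notation m := m'.+1.
Local Open Scope ring_scope.
Local Notation M := ('X^m - 1 : {poly F}).
Implicit Types (C : {set 'rV[F]_m}) (u w : 'rV[F]_m) (h g P Q : {poly F}).

Lemma size_Xm_sub_1 : size M = m.+1. Proof. exact: size_Xn_sub_1. Qed.

Lemma Xm_sub_1_neq0 : M != 0. Proof. by rewrite -size_poly_eq0 size_Xm_sub_1. Qed.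

Lemma size_modM h : (size (h %% M)%R <= m)%N.
Proof. by rewrite -ltnS -size_Xm_sub_1 ltn_modp Xm_sub_1_neq0. Qed.

Lemma size_rVpoly u : (size (rVpoly u) <= m)%N.
Proof. exact: size_poly. Qed.

Lemma modM_small h : (size h <= m)%N -> h %% M = h.
Proof. by move=> sh; rewrite modp_small // size_Xm_sub_1 ltnS. Qed.

Lemma rVpoly_cyclic_shift u : rVpoly (cyclic_shift u) = ('X * rVpoly u) %% M.
Proof.
(* The quotient is the top coefficient of u, which the shift brings back to degree 0. *)
have Xu : 'X * rVpoly u = (rVpoly u)`_m' *: M + rVpoly (cyclic_shift u).
  apply/polyP => k; rewrite coefXM coefD coefZ coefB coefXn coef1.
  have [km|mk] := ltnP k m.
    rewrite -[k in (rVpoly (cyclic_shift u))`_k]/(nat_of_ord (Ordinal km)).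
    rewrite coef_rVpoly_ord mxE -coef_rVpoly_ord /= (ltn_eqF km).
    case: k km => [|k] km /=; first by rewrite modn_small // sub0r mulrN1 addNr.
    by rewrite subr0 mulr0 add0r modnDr modn_small // ltnW.
  rewrite [(rVpoly (cyclic_shift u))`_k]nth_default ?(leq_trans (size_rVpoly _)) // addr0.
  case: k mk => // k; rewrite ltnS leq_eqVlt /= subr0 eqSS => /predU1P[<-|mk].
    by rewrite eqxx mulr1.
  by rewrite nth_default ?(leq_trans (size_rVpoly _)) // gtn_eqF // mulr0.
rewrite Xu modpD modpZl modpp scaler0 add0r modM_small //; exact: size_rVpoly.
Qed.

Lemma linear_codeP C : linear_code C ->
  0 \in C /\ forall a u w, u \in C -> w \in C -> a *: u + w \in C.
Proof.
case/andP=> C0 /forallP HC; split=> // a u w uC wC.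
by have /forall_inP/(_ u uC)/forall_inP/(_ w wC) := HC a.
Qed.

(** Extends membership to polynomials of any degree; a cyclic code then becomes an ideal containing
    X^m - 1. *)
Definition in_code C h := poly_rV (h %% M) \in C.

Lemma in_code_rVpoly C u : in_code C (rVpoly u) = (u \in C).
Proof. by rewrite /in_code modM_small ?rVpolyK // size_rVpoly. Qed.

Lemma in_code_mod C h g : h %% M = g %% M -> in_code C h = in_code C g.
Proof. by rewrite /in_code => ->. Qed.

Lemma in_codeZD C a h g : linear_code C -> in_code C h -> in_code C g ->
  in_code C (a *: h + g).
Proof.
by move=> /linear_codeP[_ HC] hC gC; rewrite /in_code modpD modpZl linearP HC.
Qed.

(** Horner induction on a: multiplication by X is the shift, and constants are handled by
    linearity. *)
Lemma in_codeM C a h : cyclic_code C -> in_code C h -> in_code C (a * h).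
Proof.
case/andP=> linC /forall_inP shC.
have C0 : in_code C 0 by have [] := linear_codeP linC; rewrite /in_code mod0p linear0.
elim/poly_ind: a h => [|a c IHa] h hC; first by rewrite mul0r.
rewrite mulrDl mul_polyC addrC; apply: in_codeZD => //.
rewrite -mulrA; apply: IHa; have := shC _ hC; rewrite -in_code_rVpoly.
rewrite rVpoly_cyclic_shift poly_rV_K ?size_modM //.
by rewrite (@in_code_mod _ _ ('X * h)) // modM_small ?size_modM // modp_mul.
Qed.

(** The generator is the gcd of X^m - 1 and all the codewords, accumulated along their enumeration;
    Bezout relations keep it in the code. *)
Lemma cyclic_code_generator C : cyclic_code C ->
  exists2 g, g %| M & forall u, (u \in C) = (g %| rVpoly u).
Proof.
move=> cycC; have [linC _] := andP cycC; have [C0 _] := linear_codeP linC.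
have inM : in_code C M by rewrite /in_code modpp linear0.
suff [g [gM gC gu]] : exists g, [/\ g %| M, in_code C g &
    all (fun u => g %| rVpoly u) (enum C)].
  exists g => // u; apply/idP/idP => [uC|/dvdpP[a uE]].
    by apply: (allP gu); rewrite mem_enum.
  by rewrite -in_code_rVpoly uE; apply: in_codeM.
have: all (mem C) (enum C) by apply/allP => u; rewrite mem_enum.
elim: (enum C) => [|u us IHus] /=; first by exists M; rewrite dvdpp.
case/andP=> uC /IHus[g [gM gC gus]]; exists (gcdp g (rVpoly u)); split.
- exact: dvdp_trans (dvdp_gcdl _ _) gM.
- have [[a b] /= /eqpf_eq[c c_neq0 abE]] := Bezoutp g (rVpoly u).
  have -> : gcdp g (rVpoly u) = c^-1 *: (a * g + b * rVpoly u) + 0.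
    by rewrite addr0 abE scalerA mulVf // scale1r.
  apply: in_codeZD => //; last by rewrite /in_code mod0p linear0.
  rewrite -[a * g]scale1r; apply: in_codeZD => //; apply: in_codeM => //.
  by rewrite in_code_rVpoly.
- rewrite dvdp_gcdr /=; apply: sub_all gus => w.
  exact/dvdp_trans/dvdp_gcdl.
Qed.

End CyclicCodeIdeals.

(** * Reciprocal polynomials *)

Section Reversal.
Variable R : nzRingType.
Local Open Scope ring_scope.
Implicit Types P B : {poly R}.

(** For P of size at most d this is X^(d-1) P(1/X). The length d is fixed independently of P, which
    makes the operation involutive even when P(0) = 0. *)
Definition rev_poly d P : {poly R} := \poly_(i < d) P`_(d.-1 - i).

Lemma rev_polyK d P : (size P <= d)%N -> rev_poly d (rev_poly d P) = P.
Proof.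
move=> sP; apply/polyP => i; rewrite !coef_poly; case: ifPn => [lt_id|]; last first.
  by rewrite -leqNgt => le_di; rewrite nth_default // (leq_trans sP).
have le_id : (i <= d.-1)%N by rewrite -ltnS (ltn_predK lt_id).
by rewrite subKn // (leq_ltn_trans (leq_subr _ _)) // ltn_predL (leq_ltn_trans _ lt_id).
Qed.

Lemma rev_polyMXsubC d a B : (size B <= d)%N ->
  rev_poly d.+1 (('X - a%:P) * B) = (1 - a *: 'X) * rev_poly d B.
Proof.
move=> sB; apply/polyP => i.
rewrite !mulrBl mul1r -scalerAl coefB coefZ coefXM !coef_poly /= coefB coefXM coefCM.
case: i => [|i] /=.
  rewrite subn0 mulr0 subr0 [B`_d]nth_default // mulr0 subr0.
  by rewrite subn0; case: d {sB}.
rewrite ltnS subn_eq0; case: (ltngtP i d) => [lt_id|lt_di|->].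
- have le_id : (i <= d.-1)%N by rewrite -ltnS (ltn_predK lt_id).
  have -> : (d.-1 - i = d - i.+1)%N by rewrite subnS -subn1 subnAC subn1.
  rewrite leqNgt; case: (i.+1 < d)%N => //=.
  by congr (B`__ - _); rewrite -subnS -subn1 -subnDA add1n.
- by rewrite mulr0 subr0 ltnNge (ltnW (leqW lt_di)).
- by rewrite ltnNge leqnSn mulr0 subr0.
Qed.

End Reversal.

Section ReversalRoots.
Variable K : fieldType.
Local Open Scope ring_scope.

(** Each factor X - a of P becomes the factor 1 - aX = -a (X - 1/a) of the reversal. *)
Lemma rev_poly_dvdp_XsubC_exp k d a (P : {poly K}) : a != 0 -> (size P <= d)%N ->
  ('X - a%:P) ^+ k %| P -> ('X - (a^-1)%:P) ^+ k %| rev_poly d P.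
Proof.
move=> a_neq0; elim: k d P => [|k IHk] d P sP; first by rewrite !expr0 !dvd1p.
case/dvdpP=> Q PE; pose B := Q * ('X - a%:P) ^+ k.
have {}PE : P = ('X - a%:P) * B by rewrite PE exprS mulrCA.
have [B0|B_neq0] := eqVneq B 0.
  have -> : rev_poly d P = 0 by apply/polyP => i; rewrite coef_poly PE B0 mulr0 !coef0; case: ifP.
  exact: dvdp0.
have sPB : size P = (size B).+1 by rewrite PE size_monicM ?monicXsubC // size_XsubC.
case: d sP => [|d]; rewrite sPB // ltnS PE => sB.
rewrite rev_polyMXsubC // exprS; apply: dvdp_mul; last first.
  by apply: IHk => //; apply: dvdp_mulIr.
rewrite (_ : 1 - a *: 'X = - a *: ('X - (a^-1)%:P)) ?dvdpZr ?oppr_eq0 //.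
by rewrite scalerBr scaleNr scaleNr opprK -mul_polyC -[a *: (_%:P)]mul_polyC -polyCM divff // addrC.
Qed.

End ReversalRoots.

(** * Orthogonality in terms of polynomial products *)

Section Duality.
Variables (F : finFieldType) (m' : nat).
Local Notation m := m'.+1.
Local Open Scope ring_scope.
Local Notation M := ('X^m - 1 : {poly F}).
Implicit Types (C : {set 'rV[F]_m}) (u w : 'rV[F]_m) (h g P Q : {poly F}).

Lemma sum_mul_coef_rev u w :
  \sum_i u 0 i * w 0 i = (rVpoly u * rev_poly m (rVpoly w))`_m'.
Proof.
rewrite coefM; apply: eq_bigr => i _; rewrite coef_rVpoly_ord coef_poly ltnS leq_subr /=.
by rewrite subKn ?coef_rVpoly_ord // -ltnS.
Qed.

Lemma size_mulM P Q : (size P <= m)%N -> (size Q <= m)%N -> (size (P * Q)%R <= m + m')%N.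
Proof.
move=> sP sQ; rewrite (leq_trans (size_polyMleq _ _)) //.
by rewrite -[(m + m')%N]/((m + m').+1.-1) -addnS -!subn1 leq_sub2r // leq_add.
Qed.

(** The quotient D has size at most m', so D X^m starts above the coefficient m' and -D stops below
    it. The bound m + m' is the one satisfied by a product of two words. *)
Lemma coef_modM Q : (size Q <= m + m')%N -> (Q %% M)`_m' = Q`_m'.
Proof.
move=> sQ; rewrite [in RHS](divp_eq Q M); set D := Q %/ M.
have sD : (size D <= m')%N.
  by rewrite size_divp ?Xm_sub_1_neq0 // size_Xm_sub_1 /= leq_subLR.
rewrite mulrBr mulr1 coefD coefB coefMXn ltnSn sub0r.
by rewrite [D`__]nth_default // oppr0 add0r.
Qed.

Lemma dual_codeP0 C u : reflect (forall w, w \in C -> \sum_i u 0 i * w 0 i = 0)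
  (u \in dual_code C).
Proof. by rewrite inE; apply: (iffP forall_inP) => H w /H/eqP. Qed.

(** The shift is injective, hence maps the finite set C onto itself; so every word of C is a shifted
    word, and shifting both arguments preserves the product. *)
Lemma cyclic_dual_code C : cyclic_code C -> cyclic_code (dual_code C).
Proof.
case/andP=> linC /forall_inP shC; apply/andP; split.
  apply/andP; split.
    by apply/dual_codeP0 => w _; rewrite big1 // => i _; rewrite mxE mul0r.
  apply/forallP => a; apply/forall_inP => u /dual_codeP0 uC.
  apply/forall_inP => u' /dual_codeP0 u'C; apply/dual_codeP0 => w wC.
  under eq_bigr => i _ do rewrite !mxE mulrDl -mulrA.
  by rewrite big_split -mulr_sumr /= uC // u'C // mulr0 addr0.
have sh_inj : injective (@cyclic_shift F m).
  move=> u w /rowP uw; apply/rowP => i; have := uw (ordS i).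
  by rewrite !mxE ordSK.
have shCE : [set cyclic_shift w | w in C] = C.
  apply/eqP; rewrite eqEcard card_imset // leqnn andbT.
  by apply/subsetP => _ /imsetP[w wC ->]; apply: shC.
apply/forall_inP => u /dual_codeP0 uC; apply/dual_codeP0 => w.
rewrite -{1}shCE => /imsetP[w' w'C ->]; rewrite -[RHS](uC _ w'C).
rewrite [RHS](reindex_inj (@ord_pred_inj m)); apply: eq_bigr => i _.
by rewrite !mxE.
Qed.

(** Orthogonality kills one coefficient of the product modulo X^m - 1; applied to all the shifts of
    u, which stay in the dual, it kills every coefficient. *)
Lemma dual_codeP C u : cyclic_code C ->
  reflect (forall w, w \in C -> M %| rVpoly u * rev_poly m (rVpoly w))
    (u \in dual_code C).
Proof.
move=> cycC; apply: (iffP idP) => [uC w wC|H]; last first.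
  apply/dual_codeP0 => w /H Muw; rewrite sum_mul_coef_rev -coef_modM.
    by rewrite (modp_eq0P _ _ Muw) coef0.
  by rewrite size_mulM ?size_poly.
apply/modp_eq0P; set P := _ %% _.
have sP : (size P <= m)%N by apply: size_modM.
apply/polyP => j; rewrite coef0; have [jm|mj] := ltnP j m; last first.
  by rewrite nth_default // (leq_trans sP).
(* Multiplication by X^k moves the coefficient j to the position m' read by the Euclidean
   product. *)
pose k := (m' - j)%N; have jE : j = (m' - k)%N by rewrite subKn.
have -> : P`_j = ('X^k * P)`_m' by rewrite coefXnM ltnNge leq_subr jE.
rewrite -coef_modM; last first.
  rewrite (leq_trans (size_polyMleq _ _)) // size_polyXn addSn /= addnC leq_add //.
  exact: leq_subr.
rewrite modp_mul mulrA -mulrC -modp_mul mulrC.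
pose u' : 'rV[F]_m := poly_rV (('X^k * rVpoly u) %% M).
have u'E : rVpoly u' = ('X^k * rVpoly u) %% M by rewrite poly_rV_K ?size_modM.
rewrite -u'E coef_modM; last first.
  by rewrite size_mulM ?size_poly.
rewrite -sum_mul_coef_rev; apply/(dual_codeP0 C) => //.
by apply: (in_codeM _ (cyclic_dual_code cycC)); rewrite in_code_rVpoly.
Qed.

End Duality.

(** * Codes defined by multiplicities at the roots of unity *)

Section IterFrobenius.
Local Open Scope ring_scope.
Variables (K : fieldType) (l : nat) (charK : l \in [pchar K]) (r : nat).

(** The proof of the characteristic is an argument so that the morphism instances below can depend
    on it. *)
Definition iter_Frobenius (_ : l \in [pchar K]) (x : K) : K := x ^+ (l ^ r)%N.
Local Notation frob := (iter_Frobenius charK).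

Lemma iter_FrobeniusD (x y : K) : (x + y) ^+ (l ^ r)%N = x ^+ (l ^ r)%N + y ^+ (l ^ r)%N.
Proof.
by apply: exprDn_pchar; rewrite pnatX pnatE ?charK // (pcharf_prime charK).
Qed.

Lemma iter_Frobenius_is_zmod_morphism : zmod_morphism frob.
Proof.
move=> x y; apply/eqP; rewrite -(inj_eq (addIr (frob y))) subrK.
by rewrite -[frob _ + _]iter_FrobeniusD subrK.
Qed.

Lemma iter_Frobenius_is_monoid_morphism : monoid_morphism frob.
Proof. by split=> [|x y]; rewrite /iter_Frobenius ?expr1n ?exprMn. Qed.

HB.instance Definition _ :=
  GRing.isZmodMorphism.Build K K frob iter_Frobenius_is_zmod_morphism.
HB.instance Definition _ :=
  GRing.isMonoidMorphism.Build K K frob iter_Frobenius_is_monoid_morphism.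

End IterFrobenius.

(** * Products of powers of distinct linear factors *)

Section LinearFactors.
Local Open Scope ring_scope.
Variables (K : fieldType) (I : finType) (a : I -> K).
Hypothesis a_inj : injective a.
Implicit Types (k : I -> nat) (P : {poly K}).

Lemma prod_XsubC_exp_neq0 k : \prod_i ('X - (a i)%:P) ^+ k i != 0.
Proof. by apply/prodf_neq0 => i _; rewrite expf_neq0 // polyXsubC_eq0. Qed.

Lemma dvdp_prod_XsubC_exp k P :
  reflect (forall i, ('X - (a i)%:P) ^+ k i %| P)
    (\prod_i ('X - (a i)%:P) ^+ k i %| P).
Proof.
have dvdE s : uniq s -> (\prod_(i <- s) ('X - (a i)%:P) ^+ k i %| P)
    = all (fun i => ('X - (a i)%:P) ^+ k i %| P) s.
  elim: s => [|i s IHs] /=; first by rewrite big_nil dvd1p.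
  case/andP=> si /IHs{}IHs; rewrite big_cons Gauss_dvdp ?IHs // big_seq.
  apply: (big_ind (coprimep _)); first exact: coprimep1.
    by move=> x y cx cy; rewrite coprimepMr cx.
  move=> j sj; apply/coprimep_expl/coprimep_expr/coprimep_XsubC2.
  by rewrite subr_eq0 (inj_eq a_inj); apply: contraNneq si => <-.
apply: (iffP idP) => [|H]; rewrite dvdE ?index_enum_uniq //; last exact/allP.
by move/allP=> H i; rewrite H ?mem_index_enum.
Qed.

Lemma mup_prod_XsubC_exp k i : mup (a i) (\prod_j ('X - (a j)%:P) ^+ k j) = k i.
Proof.
rewrite (bigD1 i) //= mupMl ?mup_XsubCX ?eqxx // rootE horner_prod.
apply/prodf_neq0 => j ji; rewrite horner_exp expf_neq0 // hornerXsubC subr_eq0.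
by rewrite (inj_eq a_inj) eq_sym.
Qed.

(** Dividing A by all its factors X - a_i with multiplicity leaves a cofactor B without root among
    the a_i. It is coprime to a product that it divides, hence constant. *)
Lemma dvdp_prod_mup k A P : A %| \prod_i ('X - (a i)%:P) ^+ k i ->
  (forall i, ('X - (a i)%:P) ^+ mup (a i) A %| P) -> A %| P.
Proof.
move=> A_dvd /dvdp_prod_XsubC_exp; set D := \prod_i _ => DP.
have A_neq0 : A != 0 by apply: dvdpN0 A_dvd (prod_XsubC_exp_neq0 k).
have /dvdpP[B AE] : D %| A by apply/dvdp_prod_XsubC_exp => i; rewrite -mup_geq.
have [B_neq0 D_neq0] : B != 0 /\ D != 0.
  by move: A_neq0; rewrite AE mulf_eq0 negb_or => /andP.
have coB : coprimep B (\prod_i ('X - (a i)%:P) ^+ k i).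
  apply: (big_ind (coprimep _)); first exact: coprimep1.
    by move=> x y cx cy; rewrite coprimepMr cx.
  move=> i _; apply: coprimep_expr; rewrite coprimep_XsubC.
  rewrite root_factor_theorem XsubC_dvd // lt0n negbK.
  have := mupM (a i) B_neq0 D_neq0; rewrite -AE mup_prod_XsubC_exp.
  by rewrite -{1}[mup _ A]add0n => /addIn <-.
have B1 : B %= 1.
  move/coprimepP: coB; apply=> //; apply: dvdp_trans A_dvd.
  by rewrite AE dvdp_mulr.
by rewrite AE (eqp_dvdl _ (eqp_mulr D B1)) mul1r.
Qed.

End LinearFactors.

(** * Cyclic codes and invariant multiplicity functions *)

Section ZeroCodes.
Local Open Scope ring_scope.
Variables (F : finFieldType) (L : fieldType) (iota : {rmorphism F -> L}).
Variables (r v n m' : nat) (z : L).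
Local Notation q := (2 ^ r)%N.
Local Notation N := (2 ^ v)%N.
Local Notation m := m'.+1.
Hypothesis cardF : #|F| = q.
Hypothesis v_gt0 : (0 < v)%N.
Hypothesis mE : m = (N * n.+1)%N.
Hypothesis z_prim : n.+1.-primitive_root z.
Hypothesis co_qn : coprime q n.+1.
Local Notation M := ('X^m - 1 : {poly F}).
Local Notation "P ^^" := (map_poly iota P) (at level 2, format "P ^^").
Implicit Types (mu nu : {ffun 'I_n.+1 -> 'I_N.+1}) (C : {set 'rV[F]_m}) (i : 'I_n.+1).

Definition zroot i : L := z ^+ i.
Local Notation fac i := ('X - (zroot i)%:P).

Definition zero_code mu : {set 'rV[F]_m} :=
  [set u | [forall i, fac i ^+ mu i %| (rVpoly u)^^]].

Lemma zero_codeP mu u :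
  reflect (forall i, fac i ^+ mu i %| (rVpoly u)^^) (u \in zero_code mu).
Proof. by rewrite inE; apply: forallP. Qed.

Definition Zp_scale_invariant mu := forall i, mu (Zp_scale q i) = mu i.

Lemma zroot_inj : injective zroot.
Proof.
move=> i j /eqP; rewrite (eq_prim_root_expr z_prim) !modn_small // => /eqP.
exact: val_inj.
Qed.

Lemma zroot_neq0 i : zroot i != 0.
Proof. apply/expf_neq0/negP => /eqP z0; have := prim_expr_order z_prim.
by move/eqP; rewrite z0 expr0n eq_sym oner_eq0. Qed.

Lemma zrootN i : zroot (- i) = (zroot i)^-1.
Proof.
apply: (mulIf (zroot_neq0 i)); rewrite mulVf ?zroot_neq0 // -exprD.
by rewrite -(prim_expr_mod z_prim) -[(_ %% _)%N]/(val (- i + i)) addNr.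
Qed.

Lemma zroot_scale i : zroot (Zp_scale q i) = zroot i ^+ q.
Proof.
by rewrite /zroot /Zp_scale Zp_mulrn /= (prim_expr_mod z_prim) exprM.
Qed.

Lemma pchar2F : 2 \in [pchar F]. Proof. exact: card_finPcharP cardF _. Qed.
Lemma pchar2L : 2 \in [pchar L]. Proof. exact: rmorph_pchar pchar2F. Qed.
Local Notation frob := (iter_Frobenius r pchar2L).

Lemma iota_frob c : frob (iota c) = iota c.
Proof. by rewrite /iter_Frobenius -rmorphXn -cardF expf_card. Qed.

Lemma map_M : M^^ = \prod_i fac i ^+ N.
Proof.
rewrite rmorphB rmorph1 /= map_polyXn prodrXl.
have -> : \prod_i fac i = 'X^(n.+1) - 1.
  by rewrite -(factor_Xn_sub_1 z_prim) big_mkord.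
have pcharP : 2 \in [pchar {poly L}] by rewrite pchar_poly pchar2L.
(* In characteristic 2 the signs are irrelevant, so -1 is turned into 1 to apply the additivity of
   the 2^v-th power. *)
rewrite -[in RHS](oppr_pchar2 pcharP 1) opprK exprDn_pchar; last first.
  by rewrite pnatX pnatE // pcharP.
by rewrite expr1n -exprM mulnC -mE -[in LHS](oppr_pchar2 pcharP 1) opprK.
Qed.

(** c is a root of X^q - X, which is the product of the X - a for a in F. *)
Lemma iota_descent (c : L) : c ^+ q = c -> exists a, iota a = c.
Proof.
move=> cq; have: root (map_poly iota ('X^#|F| - 'X)) c.
  by rewrite rmorphB /= map_polyXn map_polyX rootE !(hornerE, hornerXn) cardF cq subrr.
rewrite finField_genPoly rmorph_prod /= rootE horner_prod => /eqP/eqP.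
rewrite prodf_seq_eq0 => /hasP[a _]; rewrite /= rmorphB /= map_polyX map_polyC /=.
by rewrite hornerXsubC subr_eq0 => /eqP ->; exists a.
Qed.

Lemma poly_descent (P : {poly L}) : map_poly frob P = P -> exists p, p^^ = P.
Proof.
move=> Pq; pose f c := odflt 0 [pick a | iota a == c].
have fK k : iota (f P`_k) = P`_k.
  rewrite /f; case: pickP => [a /eqP //|no_a].
  have [|a aE] := @iota_descent P`_k; last by have := no_a a; rewrite aE eqxx.
  by rewrite -[in RHS]Pq coef_map.
exists (\poly_(k < size P) f P`_k); apply/polyP => k; rewrite coef_map coef_poly.
by case: ltnP => [_|sP] /=; rewrite ?fK // rmorph0 nth_default.
Qed.

Lemma map_frob_fac i : map_poly frob (fac i) = fac (Zp_scale q i).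
Proof. by rewrite rmorphB /= map_polyX map_polyC /= zroot_scale. Qed.

(** The Frobenius x |-> x^q permutes the linear factors by i |-> q i. Invariance of [mu] makes the
    product fixed, so its coefficients descend to F. *)
Lemma zero_code_generator mu : Zp_scale_invariant mu ->
  exists g : {poly F}, g^^ = \prod_i fac i ^+ mu i.
Proof.
move=> mu_q; apply: poly_descent; rewrite rmorph_prod /=.
rewrite [RHS](reindex_inj (Zp_scale_inj co_qn)); apply: eq_bigr => i _.
by rewrite rmorphXn /= map_frob_fac mu_q.
Qed.

Lemma dvdp_fac_M i k : (k <= N)%N -> fac i ^+ k %| M^^.
Proof.
move=> kN; rewrite map_M (bigD1 i) //=; apply: dvdp_mulr; exact: dvdp_exp2l.
Qed.

Lemma dvdp_map_mod i k (h : {poly F}) : (k <= N)%N ->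
  (fac i ^+ k %| (h %% M)^^) = (fac i ^+ k %| h^^).
Proof.
move=> kN; rewrite [in RHS](divp_eq h M) rmorphD rmorphM /= dvdp_addr //.
by apply: dvdp_mull; apply: dvdp_fac_M.
Qed.

Lemma leN mu i : (mu i <= N)%N. Proof. by rewrite -ltnS. Qed.

Lemma cyclic_zero_code mu : cyclic_code (zero_code mu).
Proof.
apply/andP; split; first apply/andP; first split.
- by apply/zero_codeP => i; rewrite !linear0 dvdp0.
- apply/forallP => a; apply/forall_inP => u /zero_codeP uC.
  apply/forall_inP => w /zero_codeP wC; apply/zero_codeP => i.
  by rewrite linearP rmorphD /= map_polyZ dvdp_addr // -mul_polyC dvdp_mull.
- apply/forall_inP => u /zero_codeP uC; apply/zero_codeP => i.
  by rewrite rVpoly_cyclic_shift dvdp_map_mod ?leN // rmorphM dvdp_mull.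
Qed.

(** The generator reduced modulo X^m - 1. The reduction preserves multiplicities only up to N, hence
    the bound on k; this one word determines [mu]. *)
Lemma zero_code_witness mu : Zp_scale_invariant mu ->
  exists2 u, u \in zero_code mu &
    forall i k, (k <= N)%N -> (fac i ^+ k %| (rVpoly u)^^) = (k <= mu i)%N.
Proof.
case/zero_code_generator => g gE; pose u : 'rV[F]_m := poly_rV (g %% M).
have uP i k : (k <= N)%N -> (fac i ^+ k %| (rVpoly u)^^) = (k <= mu i)%N.
  move=> kN; rewrite poly_rV_K ?size_modM // dvdp_map_mod // gE.
  by rewrite -mup_geq ?prod_XsubC_exp_neq0 // (mup_prod_XsubC_exp zroot_inj).
by exists u => //; apply/zero_codeP => i; rewrite uP ?leN.
Qed.

Lemma zero_code_inj mu nu : Zp_scale_invariant mu -> Zp_scale_invariant nu ->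
  zero_code mu = zero_code nu -> mu = nu.
Proof.
suff le mu1 mu2 : Zp_scale_invariant mu1 -> zero_code mu1 = zero_code mu2 ->
    forall i, (mu2 i <= mu1 i)%N.
  move=> mu_q nu_q E; apply/ffunP => i; apply: val_inj; apply/eqP.
  by rewrite eqn_leq !le.
move=> /zero_code_witness[u uC uP] E i; rewrite -uP ?leN //.
by move: uC; rewrite E => /zero_codeP.
Qed.

(** [mu] collects the multiplicities of the generator: they are at most N because it divides X^m -
    1, and invariant because its coefficients are fixed by the Frobenius. *)
Lemma zero_code_surj C : cyclic_code C ->
  exists2 mu, Zp_scale_invariant mu & C = zero_code mu.
Proof.
case/cyclic_code_generator => g gM gP.
have gM' : g^^ %| \prod_i fac i ^+ N by rewrite -map_M dvdp_map.
have g_neq0 : g^^ != 0 by apply: dvdpN0 gM' (prod_XsubC_exp_neq0 _ _).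
have mupN i : (mup (zroot i) g^^ < N.+1)%N.
  rewrite ltnS -(mup_prod_XsubC_exp zroot_inj (fun=> N) i).
  rewrite mup_geq ?prod_XsubC_exp_neq0 //; apply: dvdp_trans gM'.
  by rewrite -mup_geq.
pose mu := [ffun i => Ordinal (mupN i)].
exists mu.
  move=> i; apply: val_inj; rewrite !ffunE /=.
  have E k : (fac (Zp_scale q i) ^+ k %| g^^) = (fac i ^+ k %| g^^).
    have gE : g^^ = map_poly frob g^^.
      by apply/polyP => j; rewrite !coef_map [RHS]iota_frob.
    by rewrite {1}gE -map_frob_fac -rmorphXn /= dvdp_map.
  apply/eqP; rewrite eqn_leq; apply/andP.
  by split; [rewrite mup_geq // -E -mup_geq | rewrite mup_geq // E -mup_geq].
apply/setP => u; rewrite gP; apply/idP/zero_codeP => [gu i|uC].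
  rewrite ffunE /=; apply: dvdp_trans (_ : g^^ %| _); last by rewrite dvdp_map.
  by rewrite -mup_geq.
rewrite -(dvdp_map iota); apply: dvdp_prod_mup zroot_inj _ _ _ gM' _ => i.
by have := uC i; rewrite ffunE.
Qed.

Definition dual_mult mu : {ffun 'I_n.+1 -> 'I_N.+1} :=
  [ffun i => inord (N - mu (- i))].

Lemma dual_multE mu i : dual_mult mu i = (N - mu (- i))%N :> nat.
Proof. by rewrite ffunE inordK // ltnS leq_subr. Qed.

Lemma dual_mult_invariant mu : Zp_scale_invariant mu -> Zp_scale_invariant (dual_mult mu).
Proof.
by move=> mu_q i; apply: val_inj; rewrite /= !dual_multE Zp_scaleN mu_q.
Qed.

Lemma map_rev_poly d (P : {poly F}) : (rev_poly d P)^^ = rev_poly d P^^.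
Proof.
apply/polyP => i; rewrite coef_map [in LHS]coef_poly [RHS]coef_poly; case: ifP => _ /=.
  by rewrite coef_map.
by rewrite rmorph0.
Qed.

(** A product u(X) w*(X), with w* the reversal, must vanish to order N at each z^i. The factor w*
    brings at least [mu (- i)], and exactly that for the witness when [mu (- i)] < N, so u must
    bring the rest. *)
Lemma dual_zero_code mu : Zp_scale_invariant mu ->
  dual_code (zero_code mu) = zero_code (dual_mult mu).
Proof.
move=> mu_q; apply/setP => u; have dualP := dual_codeP u (cyclic_zero_code mu).
apply/dualP/zero_codeP.
  move=> uC i; rewrite dual_multE; have [w wC wP] := zero_code_witness mu_q.
  (* The witness is tested at the exponent k + 1, which requires k < N; for k = N nothing is asked
     of u. *)
  set k := mu (- i); have [kN|kN] := leqP N k; first by rewrite (eqP kN) dvd1p.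
  have := uC w wC; rewrite -(dvdp_map iota) rmorphM /= map_rev_poly.
  move=> /(dvdp_trans (dvdp_fac_M i (leqnn N))).
  set A := (rVpoly u)^^; set B := rev_poly m _ => AB.
  have [->|A_neq0] := eqVneq A 0; first exact: dvdp0.
  have NB : ~~ (fac i ^+ k.+1 %| B).
    apply/negP => /(rev_poly_dvdp_XsubC_exp (zroot_neq0 i) (_ : size B <= m)%N).
    rewrite size_poly rev_polyK; last by rewrite size_map_poly size_rVpoly.
    by move/(_ isT); rewrite -zrootN wP // ltnn.
  have B_neq0 : B != 0 by apply: contraNneq NB => ->; rewrite dvdp0.
  rewrite -mup_geq // leq_subLR -ltnS -addSn.
  rewrite -mup_geq ?mulf_neq0 // mupM // in AB.
  rewrite -mup_ltn // ltnS in NB.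
  by rewrite addSn ltnS (leq_trans AB) // addnC leq_add2r.
move=> uC w /zero_codeP wC; rewrite -(dvdp_map iota) map_M.
apply/(dvdp_prod_XsubC_exp zroot_inj) => i.
rewrite rmorphM /= map_rev_poly -[N in _ ^+ N](@subnK (mu (- i))) ?leN // exprD.
apply: dvdp_mul; first by rewrite -dual_multE uC.
rewrite -[zroot i]invrK -zrootN.
apply: rev_poly_dvdp_XsubC_exp; rewrite ?zroot_neq0 // size_map_poly size_rVpoly //.
Qed.

Lemma card_self_dual_cyclic_codes :
  #|self_dual_cyclic_codes F m| =
    ((2 ^ v + 1) ^ (fcard (@Zp_scale n q) [pred x | ~~ fconnect (@Zp_scale n q) x (- x)%R])./2)%N.
Proof.
rewrite addn1 -card_involution_functions; first 1 last.
- exact: Zp_scale_inj.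
- exact: opprK.
- exact: Zp_scaleN.
- by rewrite oddX orbF -lt0n.
set A := [set mu | _]; have AP mu : reflect
    (Zp_scale_invariant mu /\ forall i, (mu i + mu (- i) = N)%N) (mu \in A).
  rewrite inE; apply: (iffP forallP) => [H|[mu_q muN] i]; last first.
    by rewrite mu_q eqxx muN eqxx.
  by split=> i; have /andP[/eqP H1 /eqP H2] := H i.
rewrite -(@card_in_imset _ _ zero_code); last first.
  by move=> mu nu /AP[mu_q _] /AP[nu_q _]; apply: zero_code_inj.
apply: eq_card => C; rewrite inE; apply/andP/imsetP => [[cycC /eqP sdC]|[mu]].
  have [mu mu_q CE] := zero_code_surj cycC; exists mu => //; apply/AP; split=> // i.
  have /zero_code_inj muE : zero_code mu = zero_code (dual_mult mu).
    by rewrite -dual_zero_code // -CE.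
  by rewrite {1}muE ?dual_multE ?subnK ?leN //; apply: dual_mult_invariant.
case/AP=> mu_q muN ->; split; first exact: cyclic_zero_code.
rewrite /self_dual dual_zero_code //; apply/eqP; congr zero_code.
by apply/ffunP => i; apply: val_inj; rewrite /= dual_multE -[LHS](addnK (mu (- i))) muN.
Qed.

End ZeroCodes.

(** X^(n+1) - 1 is separable because n + 1 is nonzero in F, so its splitting field contains n + 1
    distinct roots of unity, among them a primitive one. *)
Lemma splitting_field_prim_root (F : finFieldType) (n : nat) :
    (n.+1%:R != 0 :> F)%R ->
  exists (L : fieldType) (iota : {rmorphism F -> L}) (z : L),
    (n.+1.-primitive_root z)%R.
Proof.
move=> n_neq0; have nz : ('X^(n.+1) - 1 != 0 :> {poly F})%R.
  by rewrite -size_poly_eq0 size_Xn_sub_1.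
have [L [rs rsE _]] := FinSplittingFieldFor nz.
rewrite rmorphB rmorph1 /= map_polyXn in rsE.
have : has n.+1.-primitive_root%R rs.
  apply: has_prim_root => //.
  - by apply/allP => z; rewrite /root_of_unity (eqp_root rsE) root_prod_XsubC.
  - rewrite -separable_prod_XsubC -(eqp_separable rsE) separable_Xn_sub_1 //.
    by rewrite -(rmorph_nat (GRing.in_alg L)) fmorph_eq0.
  by have /eqP := eqp_size rsE; rewrite size_Xn_sub_1 // size_prod_XsubC eqSS => /eqP->.
by case/hasP=> z _ z_prim; exists L, (GRing.in_alg L), z.
Qed.

Theorem corollary5p1
  (r q : nat) (r_ge1 : 1 <= r) (q_def : q = 2 ^ r)
  (F : finFieldType) (cardF : #|F| = q)
  (s : nat) (p e : 'I_s -> nat)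
  (p_prime : forall i, prime (p i)) (p_odd : forall i, odd (p i))
  (p_inj : injective p) (e_gt0 : forall i, 0 < e i)
  (p_sorted : forall i j : 'I_s, i <= j ->
     logn 2 (ord_mod (p i) q) <= logn 2 (ord_mod (p j) q))
  (n v m : nat) (n_def : n = \prod_(i < s) p i ^ e i)
  (v_ge1 : 1 <= v) (m_def : m = 2 ^ v * n)
  (t : nat) (b : nat -> nat) (b_grouping : grouping p q b t) :
  [/\ (#|Sigma p e q|%:R =
        \sum_(y : {dffun forall i : 'I_s, 'I_(e i).+1})
          (\prod_i phi p e i (y i))%:R /
          (\big[lcmn/1%N]_i ford p e q i (y i))%:R :> rat)%R,
      (forall k, 1 <= k <= t ->
        (#|Sigma_block p e q b k|%:R =
          \sum_(y : {dffun forall i : {i : 'I_s | in_block b k i},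
                       'I_(e (val i)).+1})
            (\prod_i phi p e (val i) (y i))%:R /
            (\big[lcmn/1%N]_i ford p e q (val i) (y i))%:R :> rat)%R),
      (* The t - 1 blocks share exactly one element. *)
      #|Sigma' p e q b t| + (t - 2) =
        \sum_(2 <= k < t.+1) #|Sigma_block p e q b k| /\
      #|Sigma'' p e q b t| = #|Sigma p e q| - #|Sigma' p e q b t| &
      (* For t = 1 the cardinal of Sigma'' is odd, and the half is rounded
         down. *)
      (2 <= t -> ~~ odd #|Sigma'' p e q b t|) /\
      #|self_dual_cyclic_codes F m| =
        (2 ^ v + 1) ^ (#|Sigma'' p e q b t|./2)].
Proof.
subst q; have q_gt0 : 0 < 2 ^ r by rewrite expn_gt0.
have co_qp i : coprime (2 ^ r) (p i) by rewrite coprimeXl // coprime2n p_odd.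
(* The modulus and the length are positive; they are rewritten as successors to fit the preceding
   results. *)
have [n' nE] : exists n', n'.+1 = \prod_i p i ^ e i.
  exists (\prod_i p i ^ e i).-1; rewrite prednK // prodn_gt0 // => i.
  by rewrite expn_gt0 prime_gt0.
have [m' mE] : exists m', m'.+1 = 2 ^ v * n'.+1.
  by exists (2 ^ v * n'.+1).-1; rewrite prednK // muln_gt0 expn_gt0.
have co_qn := co_q_order co_qp nE.
have [even_S halfE] := half_card_Sigma'' p_prime co_qp b_grouping p_odd p_inj q_gt0 nE.
split.
- exact: card_SigmaE.
- by move=> k _; apply: card_Sigma_subset.
- split; first exact: card_Sigma'.
  by rewrite /Sigma'' cardsD setTI cardsT.
split=> //; rewrite m_def n_def -nE -mE.
have char2F : (2 \in [pchar F])%R by apply: card_finPcharP cardF _.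
(* n is odd, hence invertible in characteristic 2, which provides the root of unity. *)
have n_neq0 : (n'.+1%:R != 0 :> F)%R.
  rewrite -(dvdn_pcharf char2F) dvdn2 negbK.
  by move: co_qn; rewrite coprime_pexpl // coprime2n.
have [L [iota [z z_prim]]] := splitting_field_prim_root n_neq0.
by rewrite (card_self_dual_cyclic_codes iota cardF v_ge1 mE z_prim co_qn) halfE.
Qed.
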